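(* For any $h\in H$ and any $x\in\sum_{v\in\mathcal{V}}(\delta_v-2)E_v^*+\operatorname{int}(\mathcal{S}')$ we have $$Q_h(x)=\sum_{\overline{vw}\text{ edge of }\mathcal{T}}Q_h^{vw}(x)-\sum_{v\in\mathcal{V}}(\delta_v-1)Q_h^{v}(x),$$ where $Q_h^v$ and $Q_h^{vw}$ are the counting functions associated with the one-variable series $Z_h(t_v)=\mathrm{T}[f_h(t_v)]$ and the two-variable series $Z_h(\mathbf{t}_{vw})=\mathrm{T}[f_h(\mathbf{t}_{vw})]$, respectively. In particular, the multivariable periodic constant can be expressed in terms of one- and two-variable periodic constants: $$\mathrm{pc}(Z_h(\mathbf{t}))=\sum_{\overline{vw}\text{ edge of }\mathcal{T}}\mathrm{pc}(Z_h(\mathbf{t}_{vw}))-\sum_{v\in\mathcal{V}}(\delta_v-1)\,\mathrm{pc}(Z_h(t_v)).$$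
   Context: $\mathcal{T}$ is a finite tree (a connected negative definite plumbing graph with all genera zero) with vertex set $\mathcal{V}$; $\delta_v$ is the valency of $v$. $L=\mathbb{Z}\langle E_v\rangle_{v\in\mathcal{V}}$ is a free lattice with a negative definite integral symmetric form $(\,,\,)$ such that, for $v\ne w$, $(E_v,E_w)=1$ if $\overline{vw}$ is an edge and $0$ otherwise. $L'\subset L\otimes\mathbb{Q}$ is the dual lattice, freely generated by the elements $E_v^*$ defined by $(E_v^*,E_w)=-1$ if $v=w$ and $0$ otherwise (all coordinates of $E_v^*$ in the basis $\{E_w\}$ are positive). $H=L'/L$ is a finite group; $[x]\in H$ is the class of $x\in L'$. $\mathcal{S}'=\mathbb{Z}_{\ge0}\langle E_v^*\rangle_{v}$, $\mathcal{S}'_{\mathbb{R}}=\mathbb{R}_{\ge0}\langle E_v^*\rangle_v$, and $\operatorname{int}(\mathcal{S}')=\mathbb{Z}_{>0}\langle E_v^*\rangle_{v}$. For $y=\sum_v y_vE_v\in L'$ and $\emptyset\ne\mathcal{I}\subseteq\mathcal{V}$ put $\mathbf{t}^y=\prod_{v\in\mathcal V} t_v^{y_v}$, $\mathbf{t}_{\mathcal{I}}^{y}=\prod_{v\in\mathcal{I}}t_v^{y_v}$, $\mathbf{t}_{vw}=\mathbf{t}_{\{v,w\}}$. Let $\pi_{\mathcal{I}}:\mathbb{R}\langle E_v\rangle_{v\in\mathcal{V}}\to\mathbb{R}\langle E_v\rangle_{v\in\mathcal{I}}$ be the coordinate projection. Define $f_h$ by $\prod_{v\in\mathcal{V}}(1-[E_v^*]\mathbf{t}^{E_v^*})^{\delta_v-2}=\sum_{h\in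 H}f_h(\mathbf{t})\cdot h$ (coefficients in $\mathbb{Z}[H]$), and let $f_h(\mathbf{t}_{\mathcal{I}})$ be $f_h(\mathbf{t})$ with $t_v=1$ for $v\notin\mathcal{I}$. $\mathrm{T}$ is Taylor expansion at the origin. If $\sum_{l'}p_{l'}\mathbf{t}^{l'}=\mathrm{T}[\prod_v(1-\mathbf{t}^{E_v^*})^{\delta_v-2}]$, then $Z_h(\mathbf{t}_{\mathcal{I}}):=\mathrm{T}[f_h(\mathbf{t}_{\mathcal{I}})]=\sum_{[l']=h}p_{l'}\mathbf{t}_{\mathcal{I}}^{l'}$; $Z_h(\mathbf{t})$ is the case $\mathcal{I}=\mathcal{V}$. The counting function associated with $Z_h(\mathbf{t}_{\mathcal{I}})$ is $$Q_h^{\mathcal{I}}(x)=\sum\{\,p_{l'}:[l']=h,\ \pi_{\mathcal{I}}(l')\not\ge\pi_{\mathcal{I}}(x)\,\},\qquad x\in L',$$ where $\ge$ is the coordinatewise order with respect to $\{E_v\}$ (a finite sum, depending only on $\pi_{\mathcal{I}}(x)$). Write $Q_h=Q_h^{\mathcal{V}}$, $Q_h^{v}=Q_h^{\{v\}}$, $Q_h^{vw}=Q_h^{\{v,w\}}$. A quasipolynomial on a lattice is a function whose restriction to each coset of some finite-index sublattice is a polynomial. Periodic constant: if there are a finite-index sublattice $\widetilde L\subset\pi_{\mathcal{I}}(L')$, an element $l'_*\in\pi_{\mathcal{I}}(\mathcal{S}'_{\mathbb{R}})$ and a quasipolynomial on $\widetilde L$ coinciding with $Q_h^{\mathcal{I}}$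 on $\widetilde L\cap(l'_*+\pi_{\mathcal{I}}(\mathcal{S}'_{\mathbb{R}}))$, then $\mathrm{pc}(Z_h(\mathbf{t}_{\mathcal{I}}))=\mathrm{pc}^{\pi_{\mathcal{I}}(\mathcal{S}'_{\mathbb{R}})}(Z_h(\mathbf{t}_{\mathcal{I}}))$ is the value of this quasipolynomial at $0$ (independent of the choice of $\widetilde L$). *)

(* Defs.v *)
(* MathComp, with the classical sets and real numbers of MathComp-Analysis. *)
From HB Require Import structures.
From mathcomp Require Import all_boot all_order all_algebra.
From mathcomp Require mpoly.
From mathcomp Require Import boolp classical_sets fsbigop reals.

Set Implicit Arguments.
Unset Strict Implicit.
Unset Printing Implicit Defensive.

Import Order.TTheory GRing.Theory Num.Theory.
Local Open Scope classical_set_scope.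
Local Open Scope ring_scope.

(* The vertex set is 'I_n.  Cycles of length 2 back and forth along an edge
   satisfy [ucycle], hence the bound. *)
Definition is_tree (n : nat) (e : rel 'I_n) : Prop :=
  [/\ (0 < n)%N,
      symmetric e /\ irreflexive e,
      forall v w : 'I_n, connect e v w
    & forall c : seq 'I_n, ucycle e c -> (size c <= 2)%N].

Definition valency (n : nat) (e : rel 'I_n) (v : 'I_n) : nat :=
  #|[pred w | e v w]|.

(* All vectors live in the real space 'rV[R]_n with coordinates in the basis
   (E_v): the lattices L, L' and the cone S'_R are subsets of it. *)
Section Lattice.

Variables (R : realType) (n : nat) (e : rel 'I_n) (b : 'I_n -> int).

Definition intersection_matrix : 'M[R]_n :=
  \matrix_(v, w) (if v == w then (b v)%:~R else (e v w)%:R).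

Definition iform (x y : 'rV[R]_n) : R :=
  (x *m intersection_matrix *m y^T) 0 0.

Definition negative_definite : Prop :=
  forall x : 'rV[R]_n, x != 0 -> iform x x < 0.

Definition basis_vec (v : 'I_n) : 'rV[R]_n := delta_mx 0 v.

(* The dual basis (up to sign), see [iform_EstarE]. *)
Definition Estar (v : 'I_n) : 'rV[R]_n := - row v (invmx intersection_matrix).

Definition lattice : set 'rV[R]_n :=
  [set x | forall v, x 0 v \is a Num.int].

(* A vector pairing integrally with the E_v is automatically rational, since
   the form is integral and nondegenerate on L. *)
Definition dual_lattice : set 'rV[R]_n :=
  [set x | forall w, iform x (basis_vec w) \is a Num.int].

(* The class [y] in H = L'/L is the coset y + L. *)
Definition class_of (y : 'rV[R]_n) : set 'rV[R]_n :=
  [set x | lattice (x - y)].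

Definition discriminant_group : set (set 'rV[R]_n) :=
  class_of @` dual_lattice.

Definition real_cone : set 'rV[R]_n :=
  [set y | exists2 a : 'I_n -> R, forall v, 0 <= a v
                                & y = \sum_v a v *: Estar v].

(* int(S') = Z_{>0}<E_v^*> *)
Definition int_semigroup : set 'rV[R]_n :=
  [set y | exists2 a : 'I_n -> nat, forall v, (0 < a v)%N
                                  & y = \sum_v (a v)%:R *: Estar v].

(* The coefficient of x^i in the Taylor expansion at 0 of (1 - x)^k; for
   negative k it is read off the geometric series truncated after x^i. *)
Definition taylor_coef (k : int) (i : nat) : int :=
  match k with
  | Posz m => ((1 - 'X) ^+ m : {poly int})`_i
  | Negz m => ((\sum_(j < i.+1) 'X^j) ^+ m.+1 : {poly int})`_i
  end.

(* The coefficient p_{l'} of t^{l'} in T[prod_v (1 - t^{E_v^*})^(delta_v - 2)],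
   obtained by multiplying out the expansions of the factors. *)
Definition zeta_coef (l' : 'rV[R]_n) : int :=
  \sum_(a \in [set a : {ffun 'I_n -> nat} |
                 \sum_v (a v)%:R *: Estar v = l'])
    \prod_v taylor_coef ((valency e v)%:Z - 2) (a v).

(* pi_I, with R<E_v>_{v in I} viewed as a subspace of 'rV[R]_n *)
Definition proj (I : {set 'I_n}) (x : 'rV[R]_n) : 'rV[R]_n :=
  \row_v (if v \in I then x 0 v else 0).

Definition coord_le (x y : 'rV[R]_n) : Prop := forall v, x 0 v <= y 0 v.

(* The counting function of Z_h(t_I) = sum_{[l'] = h} p_{l'} t_I^{l'}.
   The sum has finite support: all coordinates of the E_v^* are positive.
   Since [counting I h x] only depends on [proj I x], the same function serves
   as the counting function on pi_I(L'). *)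
Definition counting (I : {set 'I_n}) (h : set 'rV[R]_n) (x : 'rV[R]_n) : int :=
  \sum_(l' \in [set l' | [/\ dual_lattice l', class_of l' = h
                           & ~ coord_le (proj I x) (proj I l')]])
    zeta_coef l'.

Definition finite_index_sublattice (K Lam : set 'rV[R]_n) : Prop :=
  [/\ K `<=` Lam,
      K 0 /\ (forall x y, K x -> K y -> K (x - y))
    & exists s : seq 'rV[R]_n,
        forall x, Lam x -> exists2 y, y \in s & K (x - y)].

(* Only the values of q on Lam matter. *)
Definition quasipolynomial_on (Lam : set 'rV[R]_n) (q : 'rV[R]_n -> R) : Prop :=
  exists2 M, finite_index_sublattice M Lam &
    forall y, Lam y -> exists P : mpoly.mpoly n R,
      forall x, M (x - y) -> q x = mpoly.meval (x 0) P.

Definition is_periodic_constant (I : {set 'I_n}) (h : set 'rV[R]_n) (c : R)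
    : Prop :=
  exists (K : set 'rV[R]_n) (l0 : 'rV[R]_n) (q : 'rV[R]_n -> R),
    [/\ finite_index_sublattice K (proj I @` dual_lattice),
        (proj I @` real_cone) l0,
        quasipolynomial_on K q,
        forall x, K x -> (proj I @` real_cone) (x - l0) ->
          q x = (counting I h x)%:~R
      & c = q 0].

Definition has_periodic_constant (I : {set 'I_n}) (h : set 'rV[R]_n) : Prop :=
  exists c, is_periodic_constant I h c.

(* pc(Z_h(t_I)); the value 0 is a default, relevant only when no periodic
   constant exists. *)
Definition periodic_constant (I : {set 'I_n}) (h : set 'rV[R]_n) : R :=
  xget 0 (is_periodic_constant I h).

Lemma iform_EstarE (v w : 'I_n) :
  negative_definite -> iform (Estar v) (basis_vec w) = - (v == w)%:R.
Proof.
move=> neg; have uM : intersection_matrix \in unitmx.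
  rewrite -row_free_unit -kermx_eq0; apply/eqP/row_matrixP => i; rewrite row0.
  apply/eqP; apply: contraT => /neg.
  by rewrite /iform -row_mul mulmx_ker row0 mul0mx mxE ltxx.
rewrite /iform /Estar mulNmx -row_mul mulVmx // mulNmx !mxE.
rewrite (bigD1 w) //= big1 ?addr0 => [|k /negPf kw]; rewrite !mxE eqxx /=.
  by rewrite eqxx mulr1.
by rewrite kw mulr0.
Qed.

End Lattice.

(* Main.v *)
Require Import Defs.
From mathcomp Require Import all_boot all_order all_algebra.
From mathcomp Require mpoly.
From mathcomp Require Import boolp classical_sets fsbigop reals.
From mathcomp Require Import zify ring lra.

Set Implicit Arguments.
Unset Strict Implicit.
Unset Printing Implicit Defensive.

Import (canonicals) mpoly.
Import Order.TTheory GRing.Theory Num.Theory.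
Local Open Scope ring_scope.

(** The points l' of a class h are written l' = r + k, with r in the unit cube
    and k integral; the coefficient p_l' is then a product over the vertices v
    of coefficients of (1 - t)^(delta_v - 2) at the dual coordinates of l',
    which depend on k at v and on the sum of k over the neighbours of v only.
    So p_l' is the weight of a nearest neighbour model on the tree. The
    coefficients of (1 - t)^(delta - 2) are delta-fold differences of those of
    (1 - t)^(-2), one for each edge, and the variable of a leaf can be summed
    out: this leaves a model of the same kind on the smaller tree
    (weight_absorb), with another kernel at the neighbour of the leaf. By
    summation by parts, once differenced kernels remain 1 in a cone bounded by
    Schur complements of the intersection form (keyinv_absorb); negative
    definiteness keeps the slopes positive (dominates_gt0).

    For the counting formula, let S be the set of the v with l'_v < x_v. Then
    Q_h(x) sums the weights with S nonempty. The right-hand side sums the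
    weights times the number of vertices minus the number of edges of the
    subgraph induced on S. Attaching a leaf u to a vertex p of the tree, the
    difference of the two integrands changes by the indicator that u is the
    only element of S, minus the indicator that u is in S and p is not.
    Eliminating all vertices other than u and p, one finds the same total
    weight for both, since the kernel at p is 1 once l'_p is at least x_p and
    l'_u is below x_u (bsum_leaf, below_euler).

    As to the periodic constants, eliminating all vertices but one, Q_h^v(x)
    becomes the sum of a kernel G(k, 0) over the k below a bound Y that depends
    on x_v. Eliminating all but the ends of an edge vw, Q_h^vw(x) - Q_h^v(x)
    becomes the sum of a kernel G(k, X) over the k below Y, where X and Y
    depend on x_v and x_w (sum_below_vertex, sum_below_edge). These kernels are
    invariant under a shift (k, N) to (k + D, N + E) and have unit steps in N,
    which makes the partial sums quasipolynomials of degree two (ksum_quasi).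
    By the counting formula Q_h is a quasipolynomial as well. Periodic
    constants are unique, because two quasipolynomials that agree deep in the
    cone agree along a ray through the origin (periodic_constant_unique). *)

(** * Growing connected subgraphs of a tree *)

Section Tree.
Variables (n : nat) (e : rel 'I_n).
Implicit Types (S T A : {set 'I_n}) (u v w p q : 'I_n).

(** The edges of the subgraph induced on A. *)
Definition induced A : rel 'I_n := fun x y => [&& e x y, x \in A & y \in A].

(** The subgraph induced on A is connected. *)
Definition conn A := {in A &, forall x y, connect (induced A) x y}.

(** T arises from S by successively hanging leaves u on vertices p of connected
    subgraphs; read backwards, S is what remains of T after removing leaves. *)
Inductive grown T : {set 'I_n} -> Prop :=
| grown_refl : grown T T
| grown_step S u p : u \notin S -> p \in S -> e u p ->
    (forall q, q \in S -> e u q -> q = p) -> conn S ->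
    grown T (u |: S) -> grown T S.

Hypothesis e_sym : symmetric e.
Hypothesis e_acyclic : forall c, ucycle e c -> (size c <= 2)%N.

Lemma conn1 p : conn [set p].
Proof. by move=> x y /set1P-> /set1P->. Qed.

Lemma connU1 A p u : conn A -> p \in A -> e u p -> conn (u |: A).
Proof.
move=> cA pA eup.
have sub x y : connect (induced A) x y -> connect (induced (u |: A)) x y.
  apply: connect_sub => a c /and3P[eac aA cA']; apply: connect1.
  by rewrite /induced eac !inE aA cA' !orbT.
have up : connect (induced (u |: A)) u p.
  by apply: connect1; rewrite /induced eup !inE eqxx pA orbT.
have pu : connect (induced (u |: A)) p u.
  by apply: connect1; rewrite /induced e_sym eup !inE eqxx pA orbT.
move=> x y /setU1P[->|xA] /setU1P[->|yA] //.
- exact: connect_trans up (sub _ _ (cA _ _ pA yA)).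
- exact: connect_trans (sub _ _ (cA _ _ xA pA)) pu.
- exact: sub (cA _ _ xA yA).
Qed.

Lemma path_induced_sub A x s : path (induced A) x s -> {subset s <= A}.
Proof.
elim: s x => [|y s IHs] x //= /andP[/and3P[_ _ yA] /IHs sA] z.
by rewrite inE => /predU1P[->|/sA].
Qed.

Lemma path_induced_path A x s : path (induced A) x s -> path e x s.
Proof. by apply: sub_path => ? ? /and3P[]. Qed.

(** By acyclicity, a vertex outside a connected set has at most one neighbour
    in it. *)
Lemma unique_neighbour A u p q : conn A -> u \notin A -> p \in A -> q \in A ->
  e u p -> e u q -> q = p.
Proof.
move=> cA uA pA qA eup euq; have /connectP[s] := cA _ _ qA pA.
case/shortenP => s' pth un _ lst.
have : ucycle e (u :: q :: s').
  apply/andP; split; first by rewrite /= rcons_path euq (path_induced_path pth) -lst e_sym.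
  rewrite cons_uniq un andbT inE negb_or; apply/andP; split.
    by apply: contraNneq uA => ->.
  by apply: contra uA => /(path_induced_sub pth).
move/e_acyclic => /=; case: s' lst {pth un} => //=.
Qed.

Lemma connect_exit (r : rel 'I_n) A x y : connect r x y -> x \in A ->
  y \notin A -> exists a, exists b, [/\ r a b, a \in A & b \notin A].
Proof.
case/connectP => s; elim: s x => [|z s IHs] x /=; first by move=> _ -> ->.
case/andP => rxz pth lst xA yA; have [zA|zA] := boolP (z \in A).
  exact: IHs pth lst zA yA.
by exists x, z.
Qed.

(** A connected subgraph of a tree grows from any of its nonempty connected
    subgraphs. *)
Lemma conn_grown S T x : conn S -> conn T -> S \subset T -> x \in S -> grown T S.
Proof.
move=> cS cT ST xS; move: {2}#|T :\: S| (leqnn #|T :\: S|) => m.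
elim: m S cS ST xS => [|m IHm] S cS ST xS le_m.
  have /eqP := cards0_eq (eqP (etrans (esym (leqn0 _)) le_m)).
  rewrite finset.setD_eq0 => TS; have -> : S = T by apply/eqP; rewrite finset.eqEsubset ST.
  by constructor.
have [TS|/subsetPn[y yT yS]] := boolP (T \subset S).
  have -> : S = T by apply/eqP; rewrite finset.eqEsubset ST.
  by constructor.
have [p [u [/and3P[epu pT uT] pS uS]]] :=
  connect_exit (cT _ _ (fintype.subsetP ST _ xS) yT) xS yS.
have eup : e u p by rewrite e_sym.
apply: (grown_step (u := u) (p := p)) => //.
  by move=> q qS; apply: (unique_neighbour cS uS pS qS eup).
apply: IHm.
- exact: connU1 cS pS eup.
- by rewrite finset.subUset finset.sub1set uT ST.
- by rewrite !inE xS orbT.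
rewrite -ltnS; apply: leq_trans le_m; apply: proper_card.
apply/properP; split; first by apply: finset.setDS; apply: finset.subsetUr.
by exists u; rewrite !inE uT ?uS // eqxx.
Qed.

End Tree.

(** * Weights, box sums and elimination of a leaf *)

(** The difference operator. If g N is the coefficient of t^(a - N) in a series,
    then diff g N is that coefficient in (1 - t) times the series. *)
Definition diff (g : nat -> int) : nat -> int := fun N => g N - g N.+1.

Lemma diff_iter0 m (g : nat -> int) M : (forall N, (M <= N)%N -> g N = 0) ->
  forall N, (M <= N)%N -> iter m diff g N = 0.
Proof.
move=> g0; elim: m => [|m IHm] N MN /=; first exact: g0.
by rewrite /diff !IHm ?subrr // (leq_trans MN).
Qed.

Lemma diff_iter_sum m (I : finType) (c : I -> int) (g : I -> nat) (f : nat -> int) N :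
  iter m diff (fun N => \sum_i c i * f (N + g i)%N) N =
  \sum_i c i * iter m diff f (N + g i)%N.
Proof.
elim: m N => [|m IHm] N //=.
by rewrite /diff !IHm -sumrB; apply: eq_bigr => i _; rewrite addSn mulrBr.
Qed.

Lemma diff_iter_scale m (c : int) (f : nat -> int) N :
  iter m diff (fun N => c * f N) N = c * iter m diff f N.
Proof. by elim: m N => [|m IHm] N //=; rewrite /diff !IHm mulrBr. Qed.

Lemma sum_ord_widen (F : nat -> int) a M : (a <= M)%N ->
  (forall j, (a <= j)%N -> F j = 0) -> \sum_(j < M) F j = \sum_(j < a) F j.
Proof.
move=> aM F0; rewrite -!(big_mkord xpredT F) (big_cat_nat (n := a)) //=.
by rewrite [X in _ + X]big_nat [X in _ + X]big1 ?addr0 // => j /andP[/F0].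
Qed.

(** Summation by parts against a function f that is eventually 1: below K the
    differences of g vanish, beyond K the sum telescopes. *)
Lemma sum_step_diff (f g : nat -> int) K M : (forall j, (K <= j)%N -> f j = 1) ->
  (forall j, (j <= K)%N -> g j = 1) -> g M = 0 ->
  \sum_(j < M) f j * diff g j = 1.
Proof.
move=> f1 g1 gM; have KM : (K <= M)%N.
  by rewrite leqNgt; apply/negP => /ltnW /g1; rewrite gM.
rewrite -(big_mkord xpredT (fun j => f j * diff g j)) (big_cat_nat (n := K)) //=.
rewrite big_nat big1 ?add0r => [|j /andP[_ jK]]; last first.
  by rewrite /diff !g1 ?subrr ?mulr0 // ltnW.
rewrite (eq_big_nat _ _ (F2 := fun j => - (g j.+1 - g j))) => [|j /andP[Kj _]].
  by rewrite sumrN telescope_sumr // gM g1 // sub0r opprK.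
by rewrite f1 // mul1r opprB.
Qed.

Section Weights.
Variables (n : nat) (e : rel 'I_n).
Implicit Types (S T A : {set 'I_n}) (u v w p q : 'I_n)
  (G : 'I_n -> nat -> nat -> int).

(** The valency of v in T. *)
Definition nb T v : nat := \sum_(w in T | e v w) 1.

Definition nsum T (k : 'I_n -> nat) v : nat := \sum_(w in T | e v w) k w.

(** The weight of exponents k on T. The kernel G v has two arguments, the
    exponent at v and the sum N of the exponents at the neighbours of v in T.
    Each edge at v contributes one difference, as it does one factor 1 - t to
    (1 - t)^(delta_v - 2). *)
Definition weight T G (k : 'I_n -> nat) : int :=
  \prod_(v in T) iter (nb T v) diff (G v (k v)) (nsum T k v).

(** k with the value at u replaced by j. *)
Definition upd (k : 'I_n -> nat) u (j : nat) : 'I_n -> nat :=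
  fun v => if v == u then j else k v.

(** The kernels after the leaf u has been summed out into its neighbour p; Bd
    bounds the support of the kernels in the second argument, which makes the
    sum finite. *)
Definition absorb (Bd : 'I_n -> nat -> nat) u p G : 'I_n -> nat -> nat -> int :=
  fun v => if v == p then
    fun k N => \sum_(j < Bd p k) diff (G u j) k * diff (G p k) (N + j)
  else G v.

(** G v k vanishes from Bd v k on. *)
Definition bounded Bd T G :=
  forall v, v \in T -> forall k N, (Bd v k <= N)%N -> G v k N = 0.

Hypothesis e_sym : symmetric e.
Hypothesis e_irr : irreflexive e.

Section Leaf.
Variables (S : {set 'I_n}) (u p : 'I_n).
Hypotheses (uS : u \notin S) (pS : p \in S) (eup : e u p).
Hypothesis up_only : forall q, q \in S -> e u q -> q = p.

Lemma leaf_neq v : v \in S -> (v == u) = false.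
Proof. by move=> vS; apply: contraNF uS => /eqP <-. Qed.

(** Sums over the neighbours of a vertex after a leaf u has been hung on p. *)
Lemma sum_nbU1 (V : nmodType) (F : 'I_n -> V) v : v \in S ->
  \sum_(w in u |: S | e v w) F w =
  (if v == p then F u else 0) + \sum_(w in S | e v w) F w.
Proof.
move=> vS; rewrite big_mkcondr big_setU1 //= -big_mkcondr; congr (_ + _).
case: (eqVneq v p) => [->|vp]; first by rewrite e_sym eup.
by rewrite e_sym; case: ifP => // /(up_only vS) vp'; rewrite vp' eqxx in vp.
Qed.

Lemma sum_nb_leaf (V : nmodType) (F : 'I_n -> V) :
  \sum_(w in u |: S | e u w) F w = F p.
Proof.
rewrite big_mkcondr big_setU1 //= e_irr add0r -big_mkcondr.
rewrite (big_pred1 p) // => w; apply/andP/eqP => [[wS]|->]; last by [].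
exact: up_only.
Qed.

Lemma nbU1 v : v \in S -> nb (u |: S) v = ((v == p) + nb S v)%N.
Proof. by move=> vS; rewrite /nb (sum_nbU1 (fun=> 1%N)) //; case: (v == p). Qed.

Lemma nb_leaf : nb (u |: S) u = 1%N.
Proof. exact: sum_nb_leaf. Qed.

Lemma nsum_upd k j v : v \in S ->
  nsum (u |: S) (upd k u j) v = (nsum S k v + (if v == p then j else 0))%N.
Proof.
move=> vS; rewrite /nsum (sum_nbU1 (upd k u j)) // /upd eqxx addnC.
by congr (_ + _)%N; apply: eq_bigr => w /andP[wS _]; rewrite leaf_neq.
Qed.

Lemma weight_upd G k j : weight (u |: S) G (upd k u j) =
  diff (G u j) (k p) * iter (nb S p).+1 diff (G p (k p)) (nsum S k p + j)%N *
  \prod_(v in S :\ p) iter (nb S v) diff (G v (k v)) (nsum S k v).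
Proof.
rewrite /weight big_setU1 //= nb_leaf {1}/upd eqxx /nsum sum_nb_leaf.
rewrite {1}/upd leaf_neq // (big_setD1 p) //= mulrA; congr (_ * _ * _).
  by rewrite nbU1 // eqxx -/(nsum _ _ _) nsum_upd // eqxx /upd leaf_neq.
apply: eq_bigr => v /setD1P[vp vS].
rewrite -/(nsum _ _ _) nsum_upd // nbU1 // (negPf vp) addn0 add0n.
by rewrite /upd leaf_neq.
Qed.

(** Summing out the variable of the leaf u replaces the kernel of its
    neighbour p by the absorbed one. *)
Lemma weight_absorb Bd G k M : bounded Bd (u |: S) G -> (Bd p (k p) <= M)%N ->
  \sum_(j < M) weight (u |: S) G (upd k u j) = weight S (absorb Bd u p G) k.
Proof.
move=> bG leM; rewrite [RHS]/weight (big_setD1 p) //= {1}/absorb eqxx.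
rewrite diff_iter_sum mulr_suml.
rewrite (sum_ord_widen (F := fun j => weight (u |: S) G (upd k u j)) leM) => [|j lej]; last first.
  rewrite weight_upd (@diff_iter0 _ _ (Bd p (k p))) ?mulr0 ?mul0r // => [N leN|].
    by rewrite /= /diff !bG ?subrr ?inE ?pS ?orbT // ltnW.
  exact: leq_trans (leq_addl _ _).
apply: eq_bigr => j _; rewrite weight_upd iterSr; congr (_ * _).
by apply: eq_bigr => v /setD1P[vp _]; rewrite /absorb (negPf vp).
Qed.

Lemma bounded_absorb Bd G : bounded Bd (u |: S) G -> bounded Bd S (absorb Bd u p G).
Proof.
move=> bG v vS k N leN; rewrite /absorb; case: eqP => [vp|_]; last first.
  by apply: bG => //; rewrite !inE vS orbT.
apply: big1 => j _; rewrite vp in leN; rewrite /diff.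
rewrite [X in _ * (X - _)]bG ?[X in _ * (_ - X)]bG ?subrr ?mulr0 ?inE ?pS ?orbT //.
  by rewrite -addSn (leq_trans leN) // ltnW // addSn ltnS leq_addr.
by rewrite (leq_trans leN) // leq_addr.
Qed.

End Leaf.

(** ** Sums over boxes *)

(** The sum of F over the exponents at most B on T, and 0 off T. *)
Definition bsum B T (F : ('I_n -> nat) -> int) : int :=
  \sum_(k : {ffun 'I_n -> 'I_B.+1} | [forall v, (v \notin T) ==> (k v == ord0)])
    F (fun v => k v).

Lemma bsumU1 B S u F : u \notin S ->
  bsum B (u |: S) F = bsum B S (fun k => \sum_(j < B.+1) F (upd k u j)).
Proof.
move=> uS; rewrite /bsum pair_big /=.
pose h (a : {ffun 'I_n -> 'I_B.+1} * 'I_B.+1) : {ffun 'I_n -> 'I_B.+1} :=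
  [ffun v => if v == u then a.2 else a.1 v].
pose h' (k : {ffun 'I_n -> 'I_B.+1}) : {ffun 'I_n -> 'I_B.+1} * 'I_B.+1 :=
  ([ffun v => if v == u then ord0 else k v], k u).
rewrite (reindex_onto h h') /=; last first.
  move=> k _; apply/ffunP => v; rewrite !ffunE /=.
  by case: eqP => [->|]; rewrite ?ffunE //; case: eqP.
apply: eq_big => [[k j]|[k j] _] /=; last first.
  by congr F; apply: funext => v; rewrite ffunE /upd; case: eqP.
rewrite andbT; apply/andP/forallP => [[/forallP kS /eqP[kE _]] v|kS].
  apply/implyP => vS; case: (eqVneq v u) => [vu|vu].
    by rewrite -kE ffunE vu eqxx.
  by have := kS v; rewrite !inE (negPf vu) vS /= ffunE (negPf vu).
split.
  apply/forallP => v; rewrite !inE negb_or ffunE; apply/implyP => /andP[/negPf-> vS].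
  exact: (implyP (kS v)).
apply/eqP; rewrite /h' ffunE eqxx; congr (_, _); apply/ffunP => v; rewrite !ffunE.
by case: eqP => // ->; have := kS u; rewrite uS => /eqP.
Qed.

End Weights.

(** * Invariants of the elimination *)

Section Reduction.
Variables (R : realType) (n : nat) (e : rel 'I_n).
Variables (beta : 'I_n -> R) (Bd : 'I_n -> nat -> nat).
Implicit Types (S T A U : {set 'I_n}) (u v w p q : 'I_n)
  (G : 'I_n -> nat -> nat -> int) (gam : 'I_n -> R).

Hypothesis e_sym : symmetric e.
Hypothesis e_irr : irreflexive e.

(** The opposites of the intersection numbers of l with the E_v, for vertices
    of self-intersection -beta v. *)
Definition avec (l : 'I_n -> R) v : R := beta v * l v - \sum_(w | e v w) l w.

(* A strictly antinef vector with positive coordinates. *)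
Variable ls : 'I_n -> R.
Hypothesis ls_gt0 : forall v, 0 < ls v.
Hypothesis avec_ls : forall v, 0 < avec ls v.

(** For antinef l, the multiple gam v * l v bounds the dual coordinate of l at v
    plus the sum of l over the neighbours of v in T. So gam v plays the role of
    -E_v^2 once the vertices off T have been eliminated. *)
Definition dominates T gam := forall l : 'I_n -> R, (forall v, 0 <= avec l v) ->
  forall v, v \in T -> avec l v + \sum_(w in T | e v w) l w <= gam v * l v.

(** The Schur complement of the diagonal entry of the leaf u. *)
Definition gabsorb u p gam v : R := if v == p then gam p - (gam u)^-1 else gam v.

Lemma dominates_setT : dominates [set: 'I_n]%SET beta.
Proof.
move=> l _ v _; under eq_bigl do rewrite finset.in_setT.
by rewrite subrK.
Qed.

Lemma dominates_gt0 T gam v : dominates T gam -> v \in T -> 0 < gam v.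
Proof.
move=> dT vT; rewrite -(pmulr_lgt0 _ (ls_gt0 v)).
apply: lt_le_trans (dT ls (fun w => ltW (avec_ls w)) v vT).
by rewrite ltr_wpDr // sumr_ge0 // => w _; apply: ltW.
Qed.

(** Beyond the thresholds chi the once differenced kernel is 1, as long as N
    lies below a line of slope gam v. The slack nb - 1 accounts for rounding up
    the thresholds of the neighbours that are still to be summed out. Nothing is
    asserted at the vertices of U. *)
Definition keyinv (chi : 'I_n -> R) U T gam G :=
  forall v, v \in T -> v \notin U -> forall k N : nat, chi v <= k%:R ->
  0 <= gam v * (k%:R - chi v) - (N%:R - \sum_(w in T | e v w) chi w)
       + (nb e T v)%:R - 1 ->
  diff (G v k) N = 1.

Section Leaf.
Variables (S : {set 'I_n}) (u p : 'I_n).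
Hypotheses (uS : u \notin S) (pS : p \in S) (eup : e u p).
Hypothesis up_only : forall q, q \in S -> e u q -> q = p.

Let sum_nbU1E := @sum_nbU1 n e e_sym S u p uS eup up_only.
Let nbU1E := @nbU1 n e e_sym S u p uS eup up_only.
Let nb_leafE := @nb_leaf n e e_irr S u p uS pS eup up_only.
Let sum_nb_leafE := @sum_nb_leaf n e e_irr S u p uS pS eup up_only.

Lemma dominates_absorb gam : dominates (u |: S) gam -> dominates S (gabsorb u p gam).
Proof.
move=> dT l al v vS; have gu := dominates_gt0 dT (setU11 u S).
have := dT l al v (setU1r u vS); rewrite sum_nbU1E // /gabsorb.
case: eqP => [->|_]; last by rewrite add0r.
have := dT l al u (setU11 u S); rewrite sum_nb_leafE => lu lp.
have {}lu : l p / gam u <= l u.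
  by rewrite ler_pdivrMr // [l u * _]mulrC; apply: le_trans lu; rewrite lerDr.
by rewrite mulrBl [_^-1 * _]mulrC; lra.
Qed.

Lemma keyinv_absorb (chi : 'I_n -> R) U gam G : dominates (u |: S) gam ->
  bounded Bd (u |: S) G -> (forall v, -1 < chi v) -> u \notin U -> p \notin U ->
  keyinv chi U (u |: S) gam G -> keyinv chi U S (gabsorb u p gam) (absorb Bd u p G).
Proof.
move=> dT bG chi1 uU pU key v vS vU k N chik.
have gu := dominates_gt0 dT (setU11 u S).
have [vp|vp] := eqVneq v p; last first.
  rewrite /gabsorb /absorb (negPf vp) => ge0; apply: (key v) => //.
    by rewrite !inE vS orbT.
  by rewrite sum_nbU1E // (negPf vp) add0r nbU1E // (negPf vp) add0n.
subst v; rewrite /gabsorb /absorb !eqxx => ge0.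
(* From the least integer K above z on, the kernel of the leaf is 1. *)
pose z := chi u + (k%:R - chi p) / gam u.
have chiz : chi u <= z by rewrite lerDl divr_ge0 ?subr_ge0 // ltW.
have [K zK Kz] : exists2 K : nat, z <= K%:R & K%:R < z + 1.
  have c0 : 0 <= Num.ceil z by rewrite ceil_ge0 (lt_le_trans (chi1 u)).
  exists `|Num.ceil z|%N; rewrite natr_absz ger0_norm //; first exact: ceil_ge.
  by rewrite -ltrBlDr; have := ceilB1_lt z; rewrite intrB.
have uT := setU11 u S; have pT := setU1r u pS.
rewrite /diff -sumrB.
rewrite (eq_bigr (fun j : 'I_(Bd p k) =>
   diff (G u j) k * diff (fun j => diff (G p k) (N + j)%N) j)); last first.
  by move=> j _; rewrite -mulrBr addSn /diff !addnS.
apply: (@sum_step_diff (fun j => diff (G u j) k) (fun j => diff (G p k) (N + j)%N) K).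
- move=> j Kj; have zj : z <= j%:R by rewrite (le_trans zK) // ler_nat.
  apply: (key u) => //; first exact: le_trans zj.
  rewrite sum_nb_leafE nb_leafE //.
  have : k%:R - chi p <= gam u * (j%:R - chi u).
    by rewrite mulrC -ler_pdivrMr // lerBrDr addrC.
  by lra.
- move=> j jK; apply: (key p) => //.
  rewrite sum_nbU1E // nbU1E // !eqxx natrD.
  have : j%:R < z + 1 by rewrite (le_lt_trans _ Kz) // ler_nat.
  rewrite /z natrD; move: ge0; rewrite mulrBl [_^-1 * _]mulrC; rewrite (_ : (true : nat)%:R = 1 :> R) //; lra.
- by rewrite /diff !bG ?subrr // -?addSn leq_addl.
Qed.

(** Summing out u in a sum against a function that does not depend on it. *)
Lemma bsum_absorb B G (phi : ('I_n -> nat) -> int) : bounded Bd (u |: S) G ->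
  (forall k j, phi (upd k u j) = phi k) ->
  (forall k, weight e (u |: S) G k * phi k != 0 ->
     forall v, v \in u |: S -> (k v <= B)%N) ->
  bsum B (u |: S) (fun k => weight e (u |: S) G k * phi k) =
    bsum B S (fun k => weight e S (absorb Bd u p G) k * phi k) /\
  (forall k, weight e S (absorb Bd u p G) k * phi k != 0 ->
     forall v, v \in S -> (k v <= B)%N).
Proof.
move=> bG phiu supp.
have wE k M : (Bd p (k p) <= M)%N ->
    \sum_(j < M) weight e (u |: S) G (upd k u j) * phi (upd k u j) =
    weight e S (absorb Bd u p G) k * phi k.
  move=> leM; rewrite -(weight_absorb e_sym e_irr uS pS eup up_only bG leM) mulr_suml.
  by apply: eq_bigr => j _; rewrite phiu.
split.
  rewrite bsumU1 //; apply: eq_bigr => k0 _ /=.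
  set k : 'I_n -> nat := fun v => k0 v; rewrite -(wE k (maxn B.+1 (Bd p (k p))) (leq_maxr _ _)).
  apply/esym; apply: (sum_ord_widen (F := fun j =>
    weight e (u |: S) G (upd k u j) * phi (upd k u j)) (leq_maxl _ _)) => j Bj.
  apply/eqP/negPn/negP => /supp/(_ u (setU11 u S)).
  by rewrite /upd eqxx leqNgt Bj.
move=> k; rewrite -(wE _ _ (leqnn _)) => nz v vS.
have [j jnz] : exists j : 'I_(Bd p (k p)),
    weight e (u |: S) G (upd k u j) * phi (upd k u j) != 0.
  apply/existsP; apply: contra_neqT nz => /existsPn h.
  by apply: big1 => j _; apply/eqP; rewrite -[_ == _]negbK h.
by have := supp _ jnz v (setU1r u vS); rewrite /upd (leaf_neq uS vS).
Qed.

End Leaf.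
End Reduction.

(** * Vanishing of the reduced Euler characteristic *)

Section Euler.
Variables (R : realType) (n : nat) (e : rel 'I_n).
Variables (beta : 'I_n -> R) (Bd : 'I_n -> nat -> nat).
Implicit Types (S T A U : {set 'I_n}) (u v w p q : 'I_n)
  (G : 'I_n -> nat -> nat -> int) (gam : 'I_n -> R).

Hypothesis e_sym : symmetric e.
Hypothesis e_irr : irreflexive e.
Hypothesis e_acyclic : forall c, ucycle e c -> (size c <= 2)%N.

Variable ls : 'I_n -> R.
Hypothesis ls_gt0 : forall v, 0 < ls v.
Hypothesis avec_ls : forall v, 0 < avec e beta ls v.

Lemma weight_scale T (c : 'I_n -> nat -> int) G k :
  weight e T (fun v j N => c v j * G v j N) k =
  weight e T G k * \prod_(v in T) c v (k v).
Proof.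
rewrite mulrC /weight -big_split; apply: eq_bigr => v _ /=.
exact: diff_iter_scale.
Qed.

Lemma weight2 u p G k : e u p -> weight e (u |: [set p]) G k =
  diff (G u (k u)) (k p) * diff (G p (k p)) (k u).
Proof.
move=> eup; have up : u \notin [set p] by rewrite inE; apply: contraTneq eup => ->; rewrite e_irr.
have only q : q \in [set p] -> e u q -> q = p by rewrite inE => /eqP.
have kE : k = upd k u (k u) by apply: funext => v; rewrite /upd; case: eqP => // ->.
rewrite [in LHS]kE (weight_upd e_sym e_irr up (set11 p) eup only).
rewrite /nb /nsum !big_mkcondr !big_set1 e_irr /= [X in _ * X]big1 ?mulr1 // => v.
by rewrite !inE; case: eqP.
Qed.

Lemma grown_subset T S : grown e T S -> S \subset T.
Proof.
elim=> {S} [|S u p _ _ _ _ _ _]; first exact: fintype.subxx.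
by apply: fintype.subset_trans; apply: finset.subsetUr.
Qed.

(** Elimination of leaves, as an induction principle. *)
Lemma grown_reduce (P : {set 'I_n} -> ('I_n -> R) -> ('I_n -> nat -> nat -> int) -> Prop)
    S0 T S gam G : grown e T S -> S0 \subset S ->
  (forall S u p gam G, S0 \subset S -> u |: S \subset T ->
     u \notin S -> p \in S -> e u p -> (forall q, q \in S -> e u q -> q = p) ->
     P (u |: S) gam G -> P S (gabsorb u p gam) (absorb Bd u p G)) ->
  P T gam G -> exists gam', exists G', P S gam' G'.
Proof.
move=> gTS sub step PT; elim: gTS sub => {S} [|S u p uS pS eup only cS gr IH] sub.
  by exists gam, G.
have [] := IH _; first by apply: fintype.subset_trans sub (finset.subsetUr _ _).
move=> gam' [G' PS]; exists (gabsorb u p gam'), (absorb Bd u p G').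
by apply: step PS => //; apply: grown_subset gr.
Qed.

Variable chi : 'I_n -> R.
Hypothesis chi_gtN1 : forall v, -1 < chi v.

(** If the variable of the leaf u stays below its threshold while that of its
    neighbour p stays above, the sum over the other variables, subject to any
    thresholds from below, is that of the edge up alone. *)
Lemma bsum_leaf B S u p gam G (c : 'I_n -> nat -> int) :
  conn e S -> u \notin S -> p \in S -> e u p ->
  (forall q, q \in S -> e u q -> q = p) ->
  dominates e beta (u |: S) gam -> bounded Bd (u |: S) G ->
  keyinv e chi [set u] (u |: S) gam G ->
  (forall v j, v \in S -> chi v <= j%:R -> c v j = 1) ->
  (forall j, chi u <= j%:R -> c u j = 0) ->
  (forall j, j%:R < chi p -> c p j = 0) ->
  (forall k, weight e (u |: S) G k != 0 -> (k u)%:R < chi u ->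
     forall v, v \in u |: S -> (k v <= B)%N) ->
  bsum B (u |: S) (fun k => weight e (u |: S) G k * \prod_(v in u |: S) c v (k v)) =
  bsum B (u |: [set p]) (fun k => if chi p <= (k p)%:R then
     diff (fun N => c u (k u) * G u (k u) N) (k p) else 0).
Proof.
move=> cS uS pS eup only dT bG key c1 cu0 cp0 supp.
set T := u |: S; set S0 := u |: [set p].
pose G1 v j N := c v j * G v j N.
have up : u != p by apply: contraNneq uS => ->.
have sub : S0 \subset T by rewrite finset.setUS // finset.sub1set.
have gr : grown e T S0.
  apply: (conn_grown e_sym e_acyclic (x := u)) => //; last exact: setU11.
    by apply: (connU1 e_sym (p := p)) => //; [exact: conn1 | rewrite inE].
  exact: (connU1 e_sym (p := p)).
(* Both the truncated kernel at u and the vanishing at p below the threshold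
   survive the elimination, since u is never the parent of an eliminated leaf. *)
pose P S1 gam' G' := [/\ dominates e beta S1 gam', bounded Bd S1 G',
  keyinv e chi [set u] S1 gam' G', G' u = G1 u &
  [/\ forall j N, j%:R < chi p -> G' p j N = 0,
      (forall k, weight e S1 G' k * 1 != 0 -> forall v, v \in S1 -> (k v <= B)%N)
    & bsum B T (fun k => weight e T G1 k * 1) =
      bsum B S1 (fun k => weight e S1 G' k * 1)]].
have PT : P T gam G1.
  split => //.
  - by move=> v vT k N leN; rewrite /G1 bG // mulr0.
  - move=> v vT vu k N chik ge0; have vS : v \in S.
      by move: vT; rewrite !inE in vu *; rewrite (negPf vu).
    by rewrite /G1 /diff c1 // !mul1r; apply: key ge0.
  split => //.
    by move=> j N jp; rewrite /G1 cp0 // mul0r.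
  move=> k; rewrite mulr1 weight_scale mulf_eq0 negb_or => /andP[nz].
  rewrite big_setU1 //= mulf_eq0 negb_or => /andP[cu _]; apply: supp => //.
  by rewrite ltNge; apply: contraNN cu => /cu0/eqP.
have [|gam' [G' [dS bS keyS uE [pE _ sumE]]]] :=
    grown_reduce gr (fintype.subxx S0) _ PT.
  move=> S1 u1 p1 gam1 H sub1 sub2 u1S p1S eup1 only1 [d1 b1 k1 uE [pE s1 sumE]].
  have uS1 : u \in S1 by apply: (fintype.subsetP sub1); rewrite setU11.
  have pS1 : p \in S1 by apply: (fintype.subsetP sub1); rewrite !inE eqxx orbT.
  have u1u : u1 != u by apply: contraNneq u1S => ->.
  have p1u : p1 != u.
    apply: contraNneq u1S => p1u.
    have : u1 \in T by apply: (fintype.subsetP sub2); rewrite setU11.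
    rewrite !inE (negPf u1u) /= => u1S; rewrite (only u1) //.
    by rewrite e_sym -p1u.
  have [||sE s2] := bsum_absorb e_sym e_irr u1S p1S eup1 only1 (B := B) (phi := fun=> 1) b1 => //.
  split.
  - exact: (dominates_absorb e_sym e_irr ls_gt0 avec_ls).
  - exact: bounded_absorb.
  - by apply: (keyinv_absorb e_sym e_irr ls_gt0 avec_ls) => //; rewrite inE.
  - by rewrite /absorb eq_sym (negPf p1u).
  split => //.
    move=> j N jp; rewrite /absorb; case: eqP => [pp1|_]; last exact: pE.
    have pE1 N1 : H p1 j N1 = 0 by rewrite -pp1 pE.
    by apply: big1 => i _; rewrite /diff !pE1 subrr mulr0.
  by rewrite sumE.
rewrite (_ : (fun k => _) = (fun k => weight e T G1 k * 1)); last first.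
  by apply: funext => k; rewrite mulr1 weight_scale.
rewrite sumE; apply: eq_bigr => k _; rewrite mulr1 weight2 //.
case: (leP (chi p) (k p)%:R) => kp; last by rewrite /diff !pE // subrr mulr0.
rewrite uE; case: (ltP (k u)%:R (chi u)) => ku; last first.
  by rewrite /diff /G1 cu0 // !mul0r.
have pS0 : p \in S0 by rewrite !inE eqxx orbT.
rewrite (keyS p pS0) ?mulr1 //; first by rewrite inE eq_sym.
have gp := dominates_gt0 ls_gt0 avec_ls dS pS0.
have up' : u \notin [set p] by rewrite inE.
have only' q : q \in [set p] -> e u q -> q = p by rewrite inE => /eqP.
rewrite (nbU1 e_sym up' eup only') ?inE // eqxx.
rewrite (sum_nbU1 e_sym up' eup only') ?inE // eqxx.
rewrite /nb !big_mkcondr !big_set1 e_irr addr0 addn0.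
have : 0 <= gam' p * ((k p)%:R - chi p) by rewrite mulr_ge0 ?subr_ge0 // ltW.
by rewrite (_ : (true : nat)%:R = 1 :> R) //; move: ku; lra.
Qed.

(** The exponent at v is below its threshold. *)
Definition below (k : 'I_n -> nat) v : bool := (k v)%:R < chi v.

Definition some_below T k : bool := [exists v in T, below k v].

Lemma some_below1 v k : some_below [set v] k = below k v.
Proof.
apply/existsP/idP => [[w /andP[/set1P-> //]]|bv]; exists v.
by rewrite inE eqxx.
Qed.

Lemma some_below2 v w k : some_below [set v; w] k = below k v || below k w.
Proof.
apply/existsP/orP => [[u /andP[/set2P[->|->] bu]]|[bv|bw]]; [by left | by right | |].
  by exists v; rewrite !inE eqxx.
by exists w; rewrite !inE eqxx orbT.
Qed.

(** The Euler characteristic of the subgraph induced on the vertices of T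
    below their thresholds. *)
Definition euler T k : int := \sum_(v in T) (below k v)%:R -
  \sum_(v in T) \sum_(w in T | (v < w)%N && e v w) (below k v && below k w)%:R.

Lemma prod_bool T (f : 'I_n -> bool) :
  \prod_(v in T) (f v)%:R = [forall v in T, f v]%:R :> int.
Proof.
case: forallP => [h|/forallP/forallPn[v]].
  by apply: big1 => v vT; have := h v; rewrite vT /= => ->.
by rewrite negb_imply => /andP[vT /negPf fv]; rewrite (bigD1 v) //= fv mul0r.
Qed.

Lemma euler_leaf S u p k : u \notin S -> p \in S -> e u p ->
  (forall q, q \in S -> e u q -> q = p) ->
  euler (u |: S) k = euler S k + (below k u && ~~ below k p)%:R.
Proof.
move=> uS pS eup only; rewrite /euler big_setU1 //=.
pose f v w : int := (below k v && below k w)%:R.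
pose g v w := if (v < w)%N && e v w then f v w else 0.
have gE A : \sum_(v in A) \sum_(w in A | (v < w)%N && e v w) f v w =
    \sum_(v in A) \sum_(w in A) g v w.
  by apply: eq_bigr => v _; rewrite big_mkcondr.
rewrite -/f !gE.
have -> : \sum_(v in u |: S) \sum_(w in u |: S) g v w =
    \sum_(v in S) (g u v + g v u) + \sum_(v in S) \sum_(w in S) g v w.
  rewrite big_setU1 //= (big_setU1 _ uS) /= {1}/g ltnn /= add0r big_split /= -addrA.
  congr (_ + _); rewrite -big_split; apply: eq_bigr => v vS.
  by rewrite (big_setU1 _ uS).
have -> : \sum_(v in S) (g u v + g v u) = g u p + g p u.
  rewrite (bigD1 p) //= big1 ?addr0 // => v /andP[vS vp]; rewrite /g [e v u]e_sym.
  case: ifP => [/andP[_ /(only v vS) vp']|_]; first by rewrite vp' eqxx in vp.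
  by case: ifP => [/andP[_ /(only v vS) vp']|_] //; rewrite vp' eqxx in vp.
have up : u != p by apply: contraNneq uS => ->.
rewrite /g [e p u]e_sym eup !andbT /f andbC.
have -> : (if (u < p)%N then (below k p && below k u)%:R else 0) +
    (if (p < u)%N then (below k p && below k u)%:R else 0) =
    (below k p && below k u)%:R :> int.
  by case: ltngtP => [||/val_inj upE]; rewrite ?addr0 ?add0r // upE eqxx in up *.
by case: (below k u); case: (below k p); rewrite /= ?mulr1n ?mulr0n; ring.
Qed.

(** For every admissible system of kernels on S, the indicator of the region
    with some exponent below its threshold and the Euler characteristic of that
    region have the same total weight. *)
Definition below_euler_vanishes S := forall gam G B,
  dominates e beta S gam -> bounded Bd S G -> keyinv e chi finset.set0 S gam G ->
  (forall k, weight e S G k != 0 -> some_below S k -> forall v, v \in S -> (k v <= B)%N) ->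
  bsum B S (fun k => weight e S G k * ((some_below S k)%:R - euler S k)) = 0.

Lemma bsumD B T f g : bsum B T (fun k => f k + g k) = bsum B T f + bsum B T g.
Proof. exact: big_split. Qed.

Lemma bsumB B T f g : bsum B T (fun k => f k - g k) = bsum B T f - bsum B T g.
Proof. exact: sumrB. Qed.

Lemma some_below_upd S u k j : u \notin S -> some_below S (upd k u j) = some_below S k.
Proof.
move=> uS; apply: eq_existsb => v; case: (boolP (v \in S)) => //= vS.
by rewrite /below /upd (leaf_neq uS vS).
Qed.

Lemma euler_upd S u k j : u \notin S -> euler S (upd k u j) = euler S k.
Proof.
move=> uS; have bE v : v \in S -> below (upd k u j) v = below k v.
  by move=> vS; rewrite /below /upd (leaf_neq uS vS).
rewrite /euler (eq_bigr _ (fun v vS => congr1 (fun b : bool => b%:R) (bE v vS))).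
congr (_ - _); apply: eq_bigr => v vS; apply: eq_bigr => w /andP[wS _].
by rewrite !bE.
Qed.

Lemma euler0 S k : ~~ some_below S k -> euler S k = 0.
Proof.
move/existsPn => h; have h' v : v \in S -> below k v = false.
  by move=> vS; have := h v; rewrite vS => /negPf.
rewrite /euler !big1 ?subr0 // => v vS; last by rewrite h'.
by rewrite big1 // => w _; rewrite h'.
Qed.

(** Hanging a leaf u on p changes the difference of indicator and Euler
    characteristic by the indicator of the region where u alone is below its
    threshold, minus that of the region where u is and p is not. Both regions
    have the weight computed by bsum_leaf. *)
Lemma below_euler_step S u p : conn e S -> u \notin S -> p \in S -> e u p ->
  (forall q, q \in S -> e u q -> q = p) ->
  below_euler_vanishes S -> below_euler_vanishes (u |: S).
Proof.
move=> cS uS pS eup only IH gam G B dT bG key supp.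
pose c1 v (j : nat) : int := if v == u then (j%:R < chi u)%R%:R else (chi v <= j%:R)%R%:R.
pose c2 v (j : nat) : int := if v == u then (j%:R < chi u)%R%:R else
  if v == p then (chi p <= j%:R)%R%:R else 1.
have up : (p == u) = false := leaf_neq uS pS.
have c1E k : \prod_(v in u |: S) c1 v (k v) = (below k u && ~~ some_below S k)%:R.
  rewrite big_setU1 //= {1}/c1 eqxx -/(below k u).
  rewrite (eq_bigr (fun v => (~~ below k v)%:R)) => [|v vS]; last first.
    by rewrite /c1 (leaf_neq uS vS) /below -leNgt.
  rewrite prod_bool -natrM mulnb; congr (_ && _)%:R.
  rewrite /some_below negb_exists; apply/forallP/forallP => h v; have := h v;
    by rewrite negb_and implybE.
have c2E k : \prod_(v in u |: S) c2 v (k v) = (below k u && ~~ below k p)%:R.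
  rewrite big_setU1 //= {1}/c2 eqxx -/(below k u) (big_setD1 p) //= {1}/c2 up eqxx.
  rewrite big1 ?mulr1 => [|v /setD1P[vp vS]]; last first.
    by rewrite /c2 (leaf_neq uS vS) (negPf vp).
  by rewrite -natrM mulnb /below -leNgt.
have split k : weight e (u |: S) G k * ((some_below (u |: S) k)%:R - euler (u |: S) k) =
  weight e (u |: S) G k * ((some_below S k)%:R - euler S k) +
  (weight e (u |: S) G k * \prod_(v in u |: S) c1 v (k v) -
   weight e (u |: S) G k * \prod_(v in u |: S) c2 v (k v)).
  rewrite (euler_leaf _ uS pS eup only) c1E c2E -mulrBr -mulrDr; congr (_ * _).
  have -> : some_below (u |: S) k = below k u || some_below S k.
    apply/existsP/orP => [[v /andP[/setU1P[->|vS] bv]]|[bu|/existsP[v /andP[vS bv]]]].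
    - by left.
    - by right; apply/existsP; exists v; rewrite vS.
    - by exists u; rewrite setU11.
    - by exists v; rewrite setU1r.
  by case: (below k u); case: (below k p); case: (some_below S k);
    rewrite /= ?mulr1n ?mulr0n; ring.
rewrite (_ : (fun k => _) = fun k => weight e (u |: S) G k * ((some_below S k)%:R - euler S k) +
  (weight e (u |: S) G k * \prod_(v in u |: S) c1 v (k v) -
   weight e (u |: S) G k * \prod_(v in u |: S) c2 v (k v))); last first.
  exact: funext.
rewrite bsumD bsumB.
have sub k : some_below S k -> some_below (u |: S) k.
  by case/existsP => v /andP[vS bv]; apply/existsP; exists v; rewrite setU1r.
have [||-> supp'] := bsum_absorb e_sym e_irr uS pS eup only
    (B := B) (phi := fun k => (some_below S k)%:R - euler S k) bG.
- by move=> k j; rewrite some_below_upd // euler_upd.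
- move=> k; rewrite mulf_eq0 negb_or => /andP[nz me]; apply: supp => //.
  by apply: sub; apply: contraNT me => mS; rewrite (negPf mS) euler0 // subr0.
have [||_ suppS] := bsum_absorb e_sym e_irr uS pS eup only
    (B := B) (phi := fun k => (some_below S k)%:R) bG.
- by move=> k j; rewrite some_below_upd.
- move=> k; rewrite mulf_eq0 negb_or => /andP[nz me]; apply: supp => //.
  by apply: sub; move: me; case: (some_below S k).
rewrite (IH (gabsorb u p gam)) ?add0r; first last.
- by move=> k nz mS; apply: suppS; rewrite mulf_eq0 negb_or nz mS.
- by apply: (keyinv_absorb e_sym e_irr ls_gt0 avec_ls uS pS eup only dT bG) => //;
    rewrite finset.in_set0.
- exact: bounded_absorb.
- exact: (dominates_absorb e_sym e_irr ls_gt0 avec_ls).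
have key' : keyinv e chi [set u] (u |: S) gam G.
  by move=> v vT _; apply: key => //; rewrite finset.in_set0.
have suppu k : weight e (u |: S) G k != 0 -> (k u)%:R < chi u ->
    forall v, v \in u |: S -> (k v <= B)%N.
  move=> nz ku; apply: supp => //.
  by apply/existsP; exists u; rewrite setU11.
rewrite (bsum_leaf cS uS pS eup only dT bG key' (c := c1)) //; first last.
- by move=> j jp; rewrite /c1 up leNgt jp.
- by move=> j uj; rewrite /c1 eqxx ltNge uj.
- by move=> v j vS vj; rewrite /c1 (leaf_neq uS vS) vj.
rewrite (bsum_leaf cS uS pS eup only dT bG key' (c := c2)) //; first last.
- by move=> j jp; rewrite /c2 up eqxx leNgt jp.
- by move=> j uj; rewrite /c2 eqxx ltNge uj.
- move=> v j vS vj; rewrite /c2 (leaf_neq uS vS); case: eqP => // vp.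
  by rewrite -vp vj.
by rewrite /c1 /c2 eqxx subrr.
Qed.

Lemma below_euler T r : conn e T -> r \in T -> below_euler_vanishes T.
Proof.
move=> cT rT; have gr := conn_grown e_sym e_acyclic (@conn1 _ e r) cT.
have {gr} : grown e T [set r] by apply: (gr r); rewrite ?finset.sub1set ?inE.
have : below_euler_vanishes [set r].
  move=> gam G B _ _ _ _; apply: big1 => k _.
  rewrite some_below1 /euler !big_set1 big_mkcondr big_set1 ltnn /= subr0 subrr.
  by rewrite mulr0.
move=> van1 gr; elim: gr van1 => {cT rT} [|S u p uS pS eup only cS _ IH] van //.
exact: IH (below_euler_step cS uS pS eup only van).
Qed.

End Euler.

(** * Partial sums of step kernels *)

(** A kernel with the periodicity and the unit steps in the second variable
    that the reduced kernels enjoy; c bounds the region of irregularity. *)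
Record step_kernel (g : nat -> nat -> int) (D E c : nat) : Prop := StepKernel {
  step_D : (0 < D)%N;
  step_E : (0 < E)%N;
  step_shift : forall k N, g (k + D)%N (N + E)%N = g k N;
  step_zero : forall k N, (k < D)%N -> g k (N + E)%N = 0;
  step_unit : forall k N, (D * (N + c) <= E * k)%N -> diff (g k) N = 1 }.

(** The partial sums of a kernel in its first argument. *)
Definition ksum (g : nat -> nat -> int) N Y : int := \sum_(k < Y) g k N.

Section StepKernel.
Variables (g : nat -> nat -> int) (D E c : nat).
Hypothesis gP : step_kernel g D E c.

Lemma ksumD N Y a : ksum g N (Y + a) = ksum g N Y + \sum_(i < a) g (Y + i)%N N.
Proof. by rewrite /ksum big_split_ord. Qed.

Lemma ksum_shift N Y i : ksum g (N + E * i) (Y + D * i) = ksum g N Y.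
Proof.
elim: i => [|i IHi]; first by rewrite !muln0 !addn0.
rewrite !mulnSr !addnA -IHi [(Y + _ + D)%N]addnC ksumD /ksum big1 ?add0r.
  by apply: eq_bigr => k _; rewrite [(D + k)%N]addnC (step_shift gP).
by move=> k _; rewrite (step_zero gP).
Qed.

Lemma step_drop k N a : (D * (N + a + c) <= E * k)%N ->
  g k N - g k (N + a)%N = a%:Z.
Proof.
elim: a => [|a IHa] le_k; first by rewrite addn0 subrr.
have {}IHa : g k N - g k (N + a)%N = a%:Z.
  by apply: IHa; apply: leq_trans le_k; rewrite leq_mul2l addnS addSn leqnSn orbT.
have : diff (g k) (N + a) = 1.
  by apply: (step_unit gP); apply: leq_trans le_k; rewrite leq_mul2l addnS addSn leqnSn orbT.
rewrite /diff addnS; lia.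
Qed.

(** The second difference with step D in Y is constant. *)
Lemma ksum_diff2 N Y : (D * (N + c) <= E * Y)%N ->
  ksum g N (Y + D + D) = 2 * ksum g N (Y + D) - ksum g N Y + (D * E)%N%:Z.
Proof.
move=> le_Y; rewrite (ksumD N (Y + D)) (ksumD N Y).
suff -> : \sum_(i < D) g (Y + D + i)%N N = \sum_(i < D) g (Y + i)%N N + (D * E)%N%:Z.
  by ring.
have -> : (D * E)%N%:Z = \sum_(i < D) E%:Z.
  by rewrite sumr_const card_ord -mulr_natr mulrC PoszM natz.
rewrite -big_split; apply: eq_bigr => i _.
rewrite -(step_shift gP (Y + i) N) [(Y + D + i)%N]addnAC /=.
have := @step_drop (Y + i + D) N E; move=> <-; first by rewrite subrKC.
nia.
Qed.

Lemma ksum_quadratic N Y t : (D * (N + c) <= E * Y)%N ->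
  ksum g N (Y + D * t) = ksum g N Y + (ksum g N (Y + D) - ksum g N Y) * t%:Z
     + (D * E * 'C(t, 2))%N%:Z.
Proof.
move=> le_Y; pose h t : int := ksum g N (Y + D * t) - (ksum g N Y +
  (ksum g N (Y + D) - ksum g N Y) * t%:Z + (D * E * 'C(t, 2))%N%:Z).
suff : h t = 0 /\ h t.+1 = 0 by case=> /eqP; rewrite subr_eq0 => /eqP.
elim: t => [|t [IH1 IH2]]; rewrite /h.
  by rewrite muln0 addn0 muln1 (@bin_small 0) // (@bin_small 1) // muln0; split; ring.
split=> //; rewrite -/(h _).
have Yt : (D * (N + c) <= E * (Y + D * t))%N.
  by apply: leq_trans le_Y _; rewrite leq_mul2l leq_addr orbT.
have := ksum_diff2 Yt; move/eqP: IH1 IH2; rewrite /h subr_eq0 => /eqP IH1 /eqP.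
rewrite subr_eq0 => /eqP; rewrite !mulnSr !addnA => IH2 ->.
have -> : 'C(t.+2, 2) = ('C(t, 2) + (t + t + 1))%N by rewrite !binS !bin1 !bin0; lia.
have e1 : 'C(t.+1, 2) = ('C(t, 2) + t)%N by rewrite !binS !bin1; lia.
have tS : t.+1%:Z = t%:Z + 1 by lia.
have tSS : t.+2%:Z = t%:Z + 2 by lia.
rewrite IH1 IH2 e1 tS tSS !mulnDr !PoszD !PoszM.
move: (ksum g N Y) (ksum g N (Y + D)) (Posz 'C(t, 2)) => a b C.
ring.
Qed.

(** In the regular range, the diagonal shift by (E, D) reduces N to its residue
    modulo E, where the partial sums are quadratic along each residue class of
    Y modulo D. *)
Lemma ksum_quasi N Y : (N %/ E + c.+1 <= Y %/ D)%N ->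
  let t := (Y %/ D - (N %/ E + c.+1))%N in
  let a := ksum g (N %% E) (D * c.+1 + Y %% D) in
  let b := ksum g (N %% E) (D * c.+1 + Y %% D + D) in
  ksum g N Y = a + (b - a) * t%:Z + (D * E * 'C(t, 2))%N%:Z.
Proof.
move=> le_NY t a b; rewrite -ksum_quadratic; last first.
  have := ltn_pmod N (step_E gP); have := step_E gP; have := step_D gP.
  move: (N %% E)%N (Y %% D)%N => x y D0 E0 xE.
  have h : (x + c <= E * c.+1)%N by nia.
  by apply: (@leq_trans (D * (E * c.+1))); [rewrite leq_mul2l h orbT | nia].
rewrite -[RHS](ksum_shift _ _ (N %/ E)); congr ksum.
  by rewrite addnC mulnC -divn_eq.
rewrite {1}(divn_eq Y D) /t.
have -> : (Y %/ D)%N = (Y %/ D - (N %/ E + c.+1) + N %/ E + c.+1)%N by lia.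
move: (Y %/ D - (N %/ E + c.+1))%N (Y %% D)%N => x y; nia.
Qed.

End StepKernel.

Section Periodic.
Variables (R : realType) (n : nat) (e : rel 'I_n).
Variables (beta : 'I_n -> R) (Bd : 'I_n -> nat -> nat).
Implicit Types (S T A U : {set 'I_n}) (u v w p q : 'I_n)
  (G : 'I_n -> nat -> nat -> int) (gam : 'I_n -> R).

Hypothesis e_sym : symmetric e.
Hypothesis e_irr : irreflexive e.
Hypothesis e_acyclic : forall c, ucycle e c -> (size c <= 2)%N.

Variable ls : 'I_n -> R.
Hypothesis ls_gt0 : forall v, 0 < ls v.
Hypothesis avec_ls : forall v, 0 < avec e beta ls v.

(* The coordinates of l' are the k v + r v. *)
Variable r : 'I_n -> R.
Hypothesis r_ge0 : forall v, 0 <= r v.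
Hypothesis r_lt1 : forall v, r v < 1.

(** Where G v k N is nonzero, the sum of l' over the neighbours of v in T is at
    most gam v times the coordinate at v; here N is the part of that sum due
    to k. *)
Definition supported T gam G := forall v, v \in T -> forall k N, G v k N != 0 ->
  \sum_(w in T | e v w) r w + N%:R <= gam v * (k%:R + r v).

(** The kernels are invariant under a shift of slope gam v. *)
Definition periodic T gam G := forall v, v \in T -> exists D, exists E,
  [/\ (0 < D)%N, gam v * D%:R = E%:R &
      forall k N, G v (k + D)%N (N + E)%N = G v k N].

Lemma supported_diff T gam G v k N : supported T gam G -> v \in T ->
  diff (G v k) N != 0 ->
  \sum_(w in T | e v w) r w + N%:R <= gam v * (k%:R + r v).
Proof.
move=> sG vT; rewrite /diff subr_eq0 => dN.
have [N0|/sG-> //] := eqVneq (G v k N) 0.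
have /(sG v vT) : G v k N.+1 != 0 by rewrite eq_sym -N0.
by rewrite -natr1; lra.
Qed.

Lemma periodic_iter (g : nat -> nat -> int) D E :
  (forall k N, g (k + D)%N (N + E)%N = g k N) ->
  forall m k N, g (k + D * m)%N (N + E * m)%N = g k N.
Proof.
move=> gP; elim=> [|m IHm] k N; first by rewrite !muln0 !addn0.
by rewrite !mulnSr !addnA gP IHm.
Qed.

Section Leaf.
Variables (S : {set 'I_n}) (u p : 'I_n).
Hypotheses (uS : u \notin S) (pS : p \in S) (eup : e u p).
Hypothesis up_only : forall q, q \in S -> e u q -> q = p.

Let sum_nbU1E := @sum_nbU1 n e e_sym S u p uS eup up_only.
Let sum_nb_leafE := @sum_nb_leaf n e e_irr S u p uS pS eup up_only.

Lemma supported_absorb gam G : dominates e beta (u |: S) gam ->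
  supported (u |: S) gam G -> supported S (gabsorb u p gam) (absorb Bd u p G).
Proof.
move=> dT sG v vS k N; have gu := dominates_gt0 ls_gt0 avec_ls dT (setU11 u S).
have [vp|vp] := eqVneq v p; last first.
  rewrite /absorb /gabsorb (negPf vp) => nz; have := sG v (setU1r u vS) k N nz.
  by rewrite sum_nbU1E // (negPf vp) add0r.
subst v; rewrite /absorb /gabsorb !eqxx => nz.
have [j] : exists j : 'I_(Bd p k), diff (G u j) k * diff (G p k) (N + j) != 0.
  apply/existsP; apply: contra_neqT nz => /existsPn h.
  by apply: big1 => j _; apply/eqP; rewrite -[_ == _]negbK h.
rewrite mulf_eq0 negb_or => /andP[/(supported_diff sG (setU11 u S))].
rewrite sum_nb_leafE => ju /(supported_diff sG (setU1r u vS)).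
rewrite sum_nbU1E // eqxx natrD => jp.
have {}ju : (r p + k%:R) / gam u <= j%:R + r u by rewrite ler_pdivrMr // mulrC.
have -> : (gam p - (gam u)^-1) * (k%:R + r p) =
  gam p * (k%:R + r p) - (r p + k%:R) / gam u by ring.
by lra.
Qed.

Lemma periodic_absorb gam G : dominates e beta (u |: S) gam ->
  bounded Bd (u |: S) G ->
  supported (u |: S) gam G -> periodic (u |: S) gam G ->
  periodic S (gabsorb u p gam) (absorb Bd u p G).
Proof.
move=> dT bG sG pG v vS; have gu := dominates_gt0 ls_gt0 avec_ls dT (setU11 u S).
have [vp|vp] := eqVneq v p; last first.
  by rewrite /absorb /gabsorb (negPf vp); apply: pG; rewrite setU1r.
subst v; rewrite /absorb /gabsorb eqxx.
have gp' := dominates_gt0 ls_gt0 avec_ls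
  (dominates_absorb e_sym e_irr ls_gt0 avec_ls uS pS eup up_only dT) vS.
rewrite /gabsorb eqxx in gp'.
have [Du [Eu [Du0 gDu sh_u]]] := pG u (setU11 u S).
have [Dp [Ep [Dp0 gDp sh_p]]] := pG p (setU1r u vS).
have Eu0 : (0 < Eu)%N by rewrite -(ltr0n R) -gDu mulr_gt0 // ltr0n.
have gE : (gam p - (gam u)^-1) * (Dp * Eu)%:R = (Ep * Eu)%:R - (Du * Dp)%:R.
  have guE : (gam u)^-1 * Eu%:R = Du%:R by rewrite -gDu mulKf // gt_eqF.
  by rewrite !natrM mulrBl mulrA gDp mulrCA guE; ring.
have ltE : (Du * Dp < Ep * Eu)%N.
  by rewrite -(ltr_nat R) -subr_gt0 -gE mulr_gt0 // ltr0n muln_gt0 Dp0.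
exists (Dp * Eu)%N, (Ep * Eu - Du * Dp)%N; split.
- by rewrite muln_gt0 Dp0.
- by rewrite gE natrB // ltnW.
move=> k N; set D' := (Dp * Eu)%N; set E' := (Ep * Eu - Du * Dp)%N.
pose F k N j := diff (G u j) k * diff (G p k) (N + j).
have F0 k' N' j : (Bd p k' <= j)%N -> F k' N' j = 0.
  move=> le_j; rewrite /F /diff !(bG p (setU1r u vS)) ?subrr ?mulr0 //.
    by apply: (leq_trans le_j); lia.
  by apply: (leq_trans le_j); lia.
pose M := maxn (Bd p k) (Bd p (k + D')).
rewrite -(@sum_ord_widen (F (k + D') (N + E')) _ (Du * Dp + M)); first last.
- by move=> j; apply: F0.
- by rewrite -[X in (X <= _)%N]add0n leq_add // leq_maxr.
rewrite -(@sum_ord_widen (F k N) _ M); first last.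
- by move=> j; apply: F0.
- exact: leq_maxl.
rewrite big_split_ord /= big1 ?add0r => [|j _]; last first.
  apply/eqP; rewrite mulf_eq0; apply/orP; left; apply/negPn/negP.
  move=> /(supported_diff sG (setU11 u S)); rewrite sum_nb_leafE natrD.
  have : (j.+1)%:R <= (Du * Dp)%:R :> R by rewrite ler_nat.
  rewrite natrM -natr1 => jl.
  have : gam u * (j%:R + r u) < D'%:R.
    rewrite /D' [X in _ < X]natrM [X in _ < X]mulrC -gDu -mulrA ltr_pM2l //.
    by apply: lt_le_trans jl; rewrite ltrD2l.
  by have := r_ge0 p; have := ler0n R k; lra.
apply: eq_bigr => j _; rewrite /F /D'; congr (_ * _).
  rewrite /diff -addSn [(Dp * Eu)%N]mulnC ![(Du * Dp + j)%N]addnC.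
  by rewrite !(periodic_iter sh_u).
have -> : (N + E' + (Du * Dp + j) = N + j + Ep * Eu)%N by rewrite /E'; lia.
by rewrite /diff -addSn !(periodic_iter sh_p).
Qed.

End Leaf.

Variable chi : 'I_n -> R.
Hypothesis chi_gtN1 : forall v, -1 < chi v.

(** All the invariants of the elimination together, without exceptions. *)
Definition regular T gam G := [/\ dominates e beta T gam, bounded Bd T G,
  keyinv e chi finset.set0 T gam G, supported T gam G & periodic T gam G].

Lemma regular_step_kernel T gam G v : regular T gam G -> v \in T ->
  exists D, exists E, exists c, gam v * D%:R = E%:R /\ step_kernel (G v) D E c.
Proof.
case=> dT bG key sG pG vT; have gv := dominates_gt0 ls_gt0 avec_ls dT vT.
have [D [E [D0 gD sh]]] := pG v vT.
have E0 : (0 < E)%N by rewrite -(ltr0n R) -gD mulr_gt0 // ltr0n.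
pose x : R := `|gam v * chi v| + `|\sum_(w in T | e v w) chi w| + 1.
have x0 : 0 <= x by rewrite !addr_ge0.
have [c xc] : exists c : nat, x <= c%:R.
  by exists (Num.truncn x).+1; rewrite ltW // truncnS_gt.
exists D, E, c; split=> //; split => //.
- move=> k N kD; apply/eqP/negPn/negP => /(sG v vT).
  have : gam v * (k%:R + r v) < E%:R.
    rewrite -gD ltr_pM2l //; apply: (@lt_le_trans _ _ (k.+1)%:R); last by rewrite ler_nat.
    by rewrite -natr1 ltrD2l.
  have : 0 <= \sum_(w in T | e v w) r w by rewrite sumr_ge0.
  by rewrite natrD; have := ler0n R N; lra.
move=> k N; rewrite -(ler_nat R) !natrM natrD -gD => le_k.
have {}le_k : N%:R + c%:R <= gam v * k%:R.
  rewrite -(ler_pM2l (_ : 0 < D%:R)) ?ltr0n //.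
  by apply: (le_trans le_k); rewrite mulrAC mulrC mulrA.
have := ler_norm (gam v * chi v); have := ler_norm (- \sum_(w in T | e v w) chi w).
rewrite normrN => h1 h2; have N0 := ler0n R N; have nb0 := ler0n R (nb e T v).
have h3 := normr_ge0 (\sum_(w in T | e v w) chi w).
apply: (key v) => //; rewrite ?finset.in_set0 //.
  by rewrite -(ler_pM2l gv); move: xc; rewrite /x; lra.
by rewrite mulrBr; move: xc; rewrite /x; lra.
Qed.

(** Sums against functions of the exponents on S reduce from T to S. *)
Lemma regular_reduce T S gam G : grown e T S -> regular T gam G ->
  exists gam', exists G', regular S gam' G' /\
    forall B (phi : ('I_n -> nat) -> int),
      (forall k u j, u \notin S -> phi (upd k u j) = phi k) ->
      (forall k, weight e T G k * phi k != 0 -> forall v, v \in T -> (k v <= B)%N) ->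
      bsum B T (fun k => weight e T G k * phi k) =
      bsum B S (fun k => weight e S G' k * phi k).
Proof.
move=> gr rT.
pose P S1 gam1 G1 := regular S1 gam1 G1 /\
  forall B (phi : ('I_n -> nat) -> int),
      (forall k u j, u \notin S -> phi (upd k u j) = phi k) ->
      (forall k, weight e T G k * phi k != 0 -> forall v, v \in T -> (k v <= B)%N) ->
      bsum B T (fun k => weight e T G k * phi k) =
      bsum B S1 (fun k => weight e S1 G1 k * phi k) /\
      (forall k, weight e S1 G1 k * phi k != 0 -> forall v, v \in S1 -> (k v <= B)%N).
have [||gam' [G' [rS sumS]]] := grown_reduce gr (fintype.subxx S) (P := P) (Bd := Bd) _ (_ : P T gam G).
- move=> S1 u p gam1 G1 sub1 sub2 uS pS eup only [[dS bS kS sS pS1] sumS].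
  have keyS := keyinv_absorb e_sym e_irr ls_gt0 avec_ls uS pS eup only dS bS chi_gtN1 _ _ kS.
  split.
    split; first exact: (dominates_absorb e_sym e_irr ls_gt0 avec_ls).
    + exact: bounded_absorb.
    + by apply: keyS; rewrite finset.in_set0.
    + exact: supported_absorb.
    + exact: periodic_absorb.
  move=> B phi ind supp; have [-> supp1] := sumS B phi ind supp.
  apply: bsum_absorb => // k j; apply: ind.
  by apply: contra uS; apply: (fintype.subsetP sub1).
- by split.
by exists gam', G'; split=> // B phi ind supp; have [] := sumS B phi ind supp.
Qed.

End Periodic.

(** * Reduction to a vertex or an edge *)

Section Reduced.
Variables (R : realType) (n : nat) (e : rel 'I_n).
Variables (beta : 'I_n -> R) (Bd : 'I_n -> nat -> nat).
Implicit Types (S T A U : {set 'I_n}) (u v w p q : 'I_n)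
  (G : 'I_n -> nat -> nat -> int) (gam : 'I_n -> R).

Hypothesis e_sym : symmetric e.
Hypothesis e_irr : irreflexive e.
Hypothesis e_acyclic : forall c, ucycle e c -> (size c <= 2)%N.

Variable ls : 'I_n -> R.
Hypothesis ls_gt0 : forall v, 0 < ls v.
Hypothesis avec_ls : forall v, 0 < avec e beta ls v.

Variable r : 'I_n -> R.
Hypothesis r_ge0 : forall v, 0 <= r v.
Hypothesis r_lt1 : forall v, r v < 1.

Variable chi : 'I_n -> R.
Hypothesis chi_gtN1 : forall v, -1 < chi v.

Lemma bsum1 B v (F : ('I_n -> nat) -> int) :
  bsum B [set v] F = \sum_(j < B.+1) F (upd (fun=> 0%N) v j).
Proof.
have -> : [set v] = v |: finset.set0 by rewrite finset.setU0.
rewrite bsumU1 ?finset.in_set0 // /bsum (big_pred1 [ffun=> ord0]) => [|k].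
  apply: eq_bigr => j _; congr F; apply: funext => w.
  by rewrite /upd; case: eqP; rewrite ?ffunE.
apply/forallP/eqP => [h|-> w]; last by rewrite ffunE eqxx implybT.
by apply/ffunP => w; have := h w; rewrite finset.in_set0 ffunE => /eqP.
Qed.

Lemma bsum2 B u p (F : ('I_n -> nat) -> int) : u != p ->
  bsum B (u |: [set p]) F =
  \sum_(i < B.+1) \sum_(j < B.+1) F (upd (upd (fun=> 0%N) p i) u j).
Proof. by move=> up; rewrite bsumU1 ?inE // bsum1. Qed.

Lemma weight1 v G k : weight e [set v] G k = G v (k v) 0%N.
Proof. by rewrite /weight /nb /nsum big_set1 !big_mkcondr !big_set1 e_irr. Qed.

Lemma sum_below (f : nat -> int) (t : R) X M :
  (forall j : nat, (j%:R < t) = (j < X)%N) -> (X <= M)%N ->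
  \sum_(j < M) f j * (j%:R < t)%R%:R = \sum_(j < X) f j.
Proof.
move=> tX XM; rewrite (@sum_ord_widen (fun j => f j * (j%:R < t)%R%:R) X) => // [|j Xj].
  by apply: eq_bigr => j _; rewrite tX ltn_ord mulr1.
by rewrite tX ltnNge Xj mulr0.
Qed.

(** The weight below a threshold for the variable at v alone. *)
Lemma sum_below_vertex T gam G v : conn e T -> v \in T ->
  regular e beta Bd r chi T gam G ->
  exists g, exists D, exists E, exists c, step_kernel g D E c /\
  forall (t : R) X B, (forall j : nat, (j%:R < t) = (j < X)%N) -> (X <= B.+1)%N ->
    (forall k, weight e T G k != 0 -> (k v)%:R < t -> forall w, w \in T -> (k w <= B)%N) ->
    bsum B T (fun k => weight e T G k * ((k v)%:R < t)%R%:R) = ksum g 0 X.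
Proof.
move=> cT vT rT.
have gr : grown e T [set v].
  by apply: (conn_grown e_sym e_acyclic (x := v)) => //; [exact: conn1 | rewrite finset.sub1set | rewrite inE].
have [gam' [G' [rS sumS]]] := regular_reduce e_sym e_irr ls_gt0 avec_ls r_ge0 r_lt1 chi_gtN1 gr rT.
have [D [E [c [_ sk]]]] := regular_step_kernel ls_gt0 avec_ls r_ge0 r_lt1 rS (set11 v).
exists (G' v), D, E, c; split=> // t X B tX XB supp.
rewrite sumS.
- rewrite bsum1 /ksum -(sum_below (fun j => G' v j 0%N) tX XB).
  by apply: eq_bigr => j _; rewrite weight1 /upd eqxx.
- by move=> k u j; rewrite inE /upd eq_sym => /negPf->.
- move=> k; rewrite mulf_eq0 negb_or => /andP[nz kt]; apply: supp => //.
  by move: kt; case: ltP.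
Qed.

(** The weight of the points above the threshold at v and below that at w,
    for an edge vw and thresholds in a translate of the antinef cone. *)
Lemma sum_below_edge T gam G v w : conn e T -> v \in T -> w \in T -> e v w ->
  regular e beta Bd r chi T gam G ->
  exists g, exists D, exists E, exists c, [/\ step_kernel g D E c,
    forall l, (forall u, 0 <= avec e beta l u) ->
      D%:R * (avec e beta l w + l v) <= E%:R * l w &
  forall (t l : 'I_n -> R) X Y B,
    (forall u, 0 <= avec e beta l u) -> (forall u, 0 <= l u) ->
    t v = chi v + l v -> t w = chi w + l w ->
    (forall j : nat, (j%:R < t v) = (j < X)%N) ->
    (forall j : nat, (j%:R < t w) = (j < Y)%N) ->
    (X <= B.+1)%N -> (Y <= B.+1)%N -> (forall j, (j < Y)%N -> (Bd w j <= B.+1)%N) ->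
    (forall k, weight e T G k != 0 -> (k w)%:R < t w ->
       forall u, u \in T -> (k u <= B)%N) ->
    bsum B T (fun k => weight e T G k * (~~ ((k v)%:R < t v) && ((k w)%:R < t w))%:R) =
    ksum g X Y].
Proof.
move=> cT vT wT evw rT; set S := v |: [set w].
have vw : v != w by apply: contraTneq evw => ->; rewrite e_irr.
have wv : (w == v) = false by rewrite eq_sym (negPf vw).
have wS : w \in S by rewrite !inE eqxx orbT.
have vS : v \in S by rewrite setU11.
have vw' : v \notin [set w] by rewrite inE.
have only q : q \in [set w] -> e v q -> q = w by rewrite inE => /eqP.
have gr : grown e T S.
  apply: (conn_grown e_sym e_acyclic (x := v)) => //.
    by apply: (connU1 e_sym (p := w)) => //; [exact: conn1 | rewrite inE].
  by rewrite finset.subUset !finset.sub1set vT wT.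
have [gam' [G' [rS sumS]]] := regular_reduce e_sym e_irr ls_gt0 avec_ls r_ge0 r_lt1 chi_gtN1 gr rT.
have [D [E [c [gD sk]]]] := regular_step_kernel ls_gt0 avec_ls r_ge0 r_lt1 rS wS.
have [dS bS kS _ _] := rS.
have nbv (V : nmodType) (F : 'I_n -> V) : \sum_(q in S | e v q) F q = F w.
  exact: (sum_nb_leaf e_irr vw' (set11 w) evw only).
have nbw (V : nmodType) (F : 'I_n -> V) : \sum_(q in S | e w q) F q = F v.
  by rewrite (sum_nbU1 e_sym vw' evw only) ?inE // eqxx big_mkcondr big_set1 e_irr addr0.
have gv := dominates_gt0 ls_gt0 avec_ls dS vS.
exists (G' w), D, E, c; split=> //.
  move=> l al; have := dS l al w wS; rewrite nbw -gD => h.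
  by rewrite [gam' w * _]mulrC -mulrA ler_wpM2l.
move=> t l X Y B al l0 tv tw tX tY XB YB Bw supp.
rewrite sumS; first last.
- move=> k; rewrite mulf_eq0 negb_or => /andP[nz kt]; apply: supp => //.
  by move: kt; case: ((k w)%:R < t w) => //; rewrite andbF eqxx.
- move=> k u j; rewrite !inE negb_or /upd ![u == _]eq_sym.
  by case/andP => /negPf-> /negPf->.
rewrite bsum2 // /ksum -(sum_below (fun i => G' w i X) tY YB); apply: eq_bigr => i _.
have [iY|Yi] := ltnP i Y; last first.
  rewrite tY ltnNge Yi mulr0; apply: big1 => j _.
  by rewrite /upd wv !eqxx tY ltnNge Yi andbF mulr0.
have it : i%:R < t w by rewrite tY.
rewrite it mulr1.
have -> : G' w i X = \sum_(X <= j < B.+1) diff (G' w i) j.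
  rewrite (eq_bigr (fun j => - (G' w i j.+1 - G' w i j))) => [|j _]; last by rewrite opprB.
  by rewrite sumrN telescope_sumr // (bS w wS i B.+1) ?Bw // sub0r opprK.
rewrite -(big_mkord xpredT (fun j => weight e S G' (upd (upd (fun=> 0%N) w i) v j) *
  (~~ ((upd (upd (fun=> 0%N) w i) v j v)%:R < t v) &&
   ((upd (upd (fun=> 0%N) w i) v j w)%:R < t w))%:R)).
rewrite (big_cat_nat (n := X)) //= [X in X + _]big_nat [X in X + _]big1 ?add0r; last first.
  by move=> j /andP[_ jX]; rewrite /upd eqxx tX jX mulr0.
rewrite [LHS]big_nat_cond [RHS]big_nat_cond; apply: eq_bigr => j /andP[/andP[Xj _] _].
rewrite weight2 // /upd wv !eqxx it tX -leqNgt Xj mulr1.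
have jt : t v <= j%:R by rewrite leNgt tX -leqNgt.
rewrite (kS v) ?mul1r ?finset.in_set0 //.
  by apply: le_trans jt; rewrite tv lerDl.
rewrite nbv /nb nbv.
have := dS l al v vS; rewrite nbv => h; have := al v.
have : gam' v * l v <= gam' v * (j%:R - chi v).
  by rewrite ler_pM2l // lerBrDr addrC -tv.
by move: it; rewrite tw; lra.
Qed.

End Reduced.

(** * Quasipolynomials *)

Section Quasipolynomials.
Variables (R : realType) (n : nat).
Implicit Types (x y : 'rV[R]_n) (f : 'rV[R]_n -> R) (m : nat).

(** Congruence of all coordinates modulo m. *)
Definition eqmodv m x y := forall v, exists z : int, x 0 v - y 0 v = m%:R * z%:~R.

(** Quasipolynomials on the whole space: polynomial on each coset of some
    m Z^n. *)
Definition quasipoly f := exists2 m, (0 < m)%N &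
  forall y, exists P : mpoly.mpoly n R, forall x, eqmodv m x y ->
    f x = mpoly.meval (x 0) P.

Lemma eqmodv_dvd m m' x y : (m' %| m)%N -> eqmodv m x y -> eqmodv m' x y.
Proof.
case/dvdnP => d -> xy v; have [z ->] := xy v; exists (d%:Z * z).
by rewrite natrM intrM -pmulrn mulrCA mulrA.
Qed.

Lemma quasipolyD f g : quasipoly f -> quasipoly g -> quasipoly (fun x => f x + g x).
Proof.
move=> [m m0 fP] [m' m'0 gP]; exists (m * m')%N; first by rewrite muln_gt0 m0.
move=> y; have [P fE] := fP y; have [Q gE] := gP y; exists (P + Q) => x xy.
rewrite mpoly.mevalD (fE x) ?(gE x) //; apply: eqmodv_dvd xy.
  exact: dvdn_mull (dvdnn _).
exact: dvdn_mulr (dvdnn _).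
Qed.

Lemma quasipolyM f g : quasipoly f -> quasipoly g -> quasipoly (fun x => f x * g x).
Proof.
move=> [m m0 fP] [m' m'0 gP]; exists (m * m')%N; first by rewrite muln_gt0 m0.
move=> y; have [P fE] := fP y; have [Q gE] := gP y; exists (P * Q) => x xy.
rewrite mpoly.mevalM (fE x) ?(gE x) //; apply: eqmodv_dvd xy.
  exact: dvdn_mull (dvdnn _).
exact: dvdn_mulr (dvdnn _).
Qed.

Lemma quasipoly_periodic m f : (0 < m)%N -> (forall x y, eqmodv m x y -> f x = f y) ->
  quasipoly f.
Proof.
move=> m0 fm; exists m => // y; exists (mpoly.mpolyC n (f y)) => x /fm ->.
by rewrite mpoly.mevalC.
Qed.

Lemma quasipoly_cst a : quasipoly (fun=> a).
Proof. exact: (@quasipoly_periodic 1). Qed.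

Lemma quasipolyN f : quasipoly f -> quasipoly (fun x => - f x).
Proof.
move=> fP; rewrite (_ : (fun x => _) = fun x => (-1) * f x); last first.
  by apply: funext => x; rewrite mulN1r.
exact: quasipolyM (quasipoly_cst _) fP.
Qed.

Lemma quasipoly_sum (I : finType) (Q : pred I) (F : I -> 'rV[R]_n -> R) :
  (forall i, Q i -> quasipoly (F i)) -> quasipoly (fun x => \sum_(i | Q i) F i x).
Proof.
move=> FP; elim: (index_enum I) => [|i s IHs].
  rewrite (_ : (fun x => _) = fun=> 0); first exact: quasipoly_cst.
  by apply: funext => x; rewrite big_nil.
have [Qi|Qi] := boolP (Q i).
  rewrite (_ : (fun x => _) = fun x => F i x + \sum_(j <- s | Q j) F j x).
    by apply: quasipolyD => //; apply: FP.
  by apply: funext => x; rewrite big_cons Qi.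
rewrite (_ : (fun x => _) = fun x => \sum_(j <- s | Q j) F j x) //.
by apply: funext => x; rewrite big_cons (negPf Qi).
Qed.

(** The ceiling of x_v - s. *)
Definition xceil (s : R) (v : 'I_n) x : int := Num.ceil (x 0 v - s).

Lemma ceil_eqmodv m x y s v : eqmodv m x y -> exists2 z : int,
  x 0 v - y 0 v = m%:R * z%:~R &
  xceil s v x = xceil s v y + m%:Z * z.
Proof.
move=> /(_ v)[z xy]; exists z => //; rewrite /xceil.
have -> : x 0 v - s = (y 0 v - s) + (m%:Z * z)%:~R.
  by rewrite intrM -[m%:Z%:~R]/(m%:R) -xy; ring.
by rewrite ceilDrz ?intr_int // intrKceil.
Qed.

Lemma quasipoly_divz D s v : (0 < D)%N ->
  quasipoly (fun x => (xceil s v x %/ D%:Z)%Z%:~R).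
Proof.
move=> D0; exists D => // y.
exists (mpoly.mpolyC n ((xceil s v y %/ D%:Z)%Z%:~R - y 0 v / D%:R) +
  mpoly.mpolyC n (D%:R^-1) * mpoly.mpolyX R (mpoly.mnm1 v)) => x xy.
have [z xyz ->] := ceil_eqmodv s v xy.
rewrite mpoly.mevalD mpoly.mevalM !mpoly.mevalC mpoly.mevalXU.
have D0' : D%:R != 0 :> R by rewrite pnatr_eq0 -lt0n.
rewrite [_%:Z * z]mulrC addrC divzMDl ?intrD; last by rewrite -lt0n.
have -> : z%:~R = (x 0 v - y 0 v) / D%:R by rewrite xyz mulrC mulKf.
by ring.
Qed.

Lemma modz_eqmodv D m x y s v : (D %| m)%N -> eqmodv m x y ->
  (xceil s v x %% D%:Z)%Z = (xceil s v y %% D%:Z)%Z.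
Proof.
case/dvdnP => d -> /(ceil_eqmodv s v)[z _ ->].
by rewrite PoszM -mulrA mulrCA addrC [D%:Z * _]mulrC modzMDl.
Qed.

Variables (g : nat -> nat -> int) (D E c : nat).
Hypothesis gP : step_kernel g D E c.

(** The formula of ksum_quasi, with quotients and residues of integers, so that
    it makes sense for all N and Y. *)
Definition qstep (N Y : int) : R :=
  let a := ksum g `|(N %% E%:Z)%Z| (D * c.+1 + `|(Y %% D%:Z)%Z|) in
  let b := ksum g `|(N %% E%:Z)%Z| (D * c.+1 + `|(Y %% D%:Z)%Z| + D) in
  let t : R := (Y %/ D%:Z)%Z%:~R - (N %/ E%:Z)%Z%:~R - c.+1%:R in
  a%:~R + (b - a)%:~R * t + (D * E)%:R / 2 * (t * (t - 1)).

Lemma bin2_mul t : ('C(t, 2) * 2 = t * t.-1)%N.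
Proof. by rewrite -[2%N]/(2`!) bin_ffact ffactnS ffactn1. Qed.

Lemma qstepE (N Y : nat) : (N %/ E + c.+1 <= Y %/ D)%N ->
  qstep N Y = (ksum g N Y)%:~R.
Proof.
move=> le_NY; rewrite (ksum_quasi gP le_NY) /qstep !modz_nat !divz_nat !absz_nat.
set a := ksum _ _ _; set b := ksum _ _ _.
set t := (Y %/ D - (N %/ E + c.+1))%N.
have -> : (Posz (Y %/ D))%:~R - (Posz (N %/ E))%:~R - c.+1%:R = t%:R :> R.
  by rewrite /t natrB // natrD -!pmulrn; ring.
have posE (i : nat) : (Posz i)%:~R = i%:R :> R by [].
rewrite [in RHS]intrD [in RHS]intrD intrM !posE; congr (_ + _).
rewrite [in RHS]natrM -mulrA; congr (_ * _).
have /(congr1 (fun i : nat => i%:R : R)) := bin2_mul t; rewrite !natrM => h.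
have -> : 'C(t, 2)%:R = t%:R * t.-1%:R / 2 :> R by rewrite -h mulfK // pnatr_eq0.
rewrite mulrC; case: t {h} => [|t]; first by rewrite !mul0r.
by rewrite /= -[t.+1%:R]natr1 addrK.
Qed.

Lemma quasipoly_qstep s s' v w :
  quasipoly (fun x => qstep (xceil s v x) (xceil s' w x)) /\
  forall N, quasipoly (fun x => qstep N (xceil s' w x)).
Proof.
have [D0 E0] := (step_D gP, step_E gP).
have qt t : quasipoly t -> quasipoly (fun x => (D * E)%:R / 2 * (t x * (t x - 1))).
  move=> tP; apply: (quasipolyM (quasipoly_cst _)); apply: (quasipolyM tP).
  exact: quasipolyD tP (quasipoly_cst _).
have qN := quasipoly_divz s v E0; have qY := quasipoly_divz s' w D0.
split=> [|N].
  have tP : quasipoly (fun x => (xceil s' w x %/ D%:Z)%Z%:~R -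
      (xceil s v x %/ E%:Z)%Z%:~R - c.+1%:R).
    apply: (fun h => quasipolyD h (quasipoly_cst _)); exact: quasipolyD qY (quasipolyN qN).
  apply: (fun h => quasipolyD h (qt _ tP)); apply: quasipolyD; last apply: (fun h => quasipolyM h tP).
    apply: (@quasipoly_periodic (D * E)); first by rewrite muln_gt0 D0.
    by move=> x y xy; rewrite (modz_eqmodv s' w (dvdn_mulr E (dvdnn D)) xy)
      (modz_eqmodv s v (dvdn_mull D (dvdnn E)) xy).
  apply: (@quasipoly_periodic (D * E)); first by rewrite muln_gt0 D0.
  by move=> x y xy; rewrite (modz_eqmodv s' w (dvdn_mulr E (dvdnn D)) xy)
      (modz_eqmodv s v (dvdn_mull D (dvdnn E)) xy).
have tP : quasipoly (fun x => (xceil s' w x %/ D%:Z)%Z%:~R -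
    (N %/ E%:Z)%Z%:~R - c.+1%:R).
  apply: (fun h => quasipolyD h (quasipoly_cst _)); exact: quasipolyD qY (quasipoly_cst _).
apply: (fun h => quasipolyD h (qt _ tP)); apply: quasipolyD; last apply: (fun h => quasipolyM h tP).
  apply: (@quasipoly_periodic D) => // x y xy.
  by rewrite (modz_eqmodv s' w (dvdnn D) xy).
apply: (@quasipoly_periodic D) => // x y xy.
by rewrite (modz_eqmodv s' w (dvdnn D) xy).
Qed.

End Quasipolynomials.

(** * The lattice of a plumbing tree *)

(** The coefficients of (1 - t)^(m - 2), extended by zero. *)
Definition tcoef (m : nat) (z : int) : int :=
  if z is Posz i then taylor_coef (m%:Z - 2) i else 0.

(** The coefficients of (1 - t)^(-2), extended by zero. *)
Definition ramp (z : int) : int := if z is Posz i then i.+1%:Z else 0.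

Lemma ramp_lt0 z : z < 0 -> ramp z = 0. Proof. by case: z. Qed.

Lemma ramp_ge0 z : 0 <= z -> ramp z = z + 1.
Proof. by case: z => //= m _; rewrite addrC -intS. Qed.

Lemma coef_geom (k i : nat) :
  (\sum_(j < k) 'X^j : {poly int})`_i = (i < k)%N%:R.
Proof.
rewrite coef_sum; case: ltnP => ik.
  rewrite (bigD1 (Ordinal ik)) //= coefXn eqxx big1 ?addr0 // => j ji.
  by rewrite coefXn; case: eqP => // ij; rewrite -val_eqE /= ij eqxx in ji.
by apply: big1 => j _; rewrite coefXn; case: eqP => // ij; have := ltn_ord j; rewrite -ij ltnNge ik.
Qed.

Lemma tcoef0 z : tcoef 0 z = ramp z.
Proof.
case: z => //= i; rewrite expr2 coefM.
rewrite (eq_bigr (fun=> 1)) => [|j _]; first by rewrite sumr_const card_ord natz.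
by rewrite !coef_geom ltn_ord ltnS leq_subr mulr1.
Qed.

Lemma tcoef1 z : tcoef 1 z = (0 <= z)%R%:R.
Proof.
case: z => //= i; rewrite expr1 coef_geom ltnS leqnn.
by [].
Qed.

Lemma tcoefS m z : tcoef m.+1 z = tcoef m z - tcoef m (z - 1).
Proof.
case: m => [|[|m]].
- rewrite tcoef1 !tcoef0; case: (ltP z 0) => z0.
    by rewrite !ramp_lt0 ?subrr //; lia.
  rewrite (ramp_ge0 z0); case: (ltP (z - 1) 0) => z1.
    rewrite ramp_lt0 //; lia.
  rewrite ramp_ge0 //; lia.
- rewrite !tcoef1; case: z => [[|i]|i] //=.
    by rewrite expr0 coef1 subr0.
  rewrite expr0 coef1 /=.
  by rewrite subrr.
have e1 : (m.+3%:Z - 2) = Posz m.+1 by lia.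
have e2 : (m.+2%:Z - 2) = Posz m by lia.
case: z => [i|i] //; rewrite /tcoef e1 e2 {e1 e2}.
have cE j : (((1 - 'X) ^+ m.+1 : {poly int})`_j = ((1 - 'X) ^+ m : {poly int})`_j -
    (if j == 0%N then 0 else ((1 - 'X) ^+ m : {poly int})`_j.-1))%R.
  by rewrite exprSr mulrBr mulr1 coefB coefMX.
case: i => [|i]; first by rewrite [LHS]cE.
have -> : i.+1%:Z - 1 = Posz i by lia.
by rewrite [LHS]cE.
Qed.

Lemma diff_ramp m z N : iter m diff (fun N => ramp (z - N%:Z)) N = tcoef m (z - N%:Z).
Proof.
elim: m N => [|m IHm] N /=; first by rewrite tcoef0.
by rewrite /diff !IHm tcoefS; congr (_ - tcoef _ _); lia.
Qed.

Section Lattice.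
Variables (R : realType) (n : nat) (e : rel 'I_n) (b : 'I_n -> int).
Hypothesis htree : is_tree e.
Hypothesis hneg : negative_definite R e b.

Let M := intersection_matrix R e b.

Let e_sym : symmetric e. Proof. by case: htree => _ []. Qed.
Let e_irr : irreflexive e. Proof. by case: htree => _ []. Qed.
Let e_acyclic : forall c, ucycle e c -> (size c <= 2)%N.
Proof. by case: htree. Qed.
Let e_conn v w : connect e v w. Proof. by case: htree. Qed.

(** The opposite of the self-intersection number of E_v. *)
Definition self_int v : R := - (b v)%:~R.

(** The coordinates of a vector in the basis (E_v^* ), that is, the opposites
    of its intersection numbers with the E_v. *)
Definition dual_coord (x : 'rV[R]_n) : 'I_n -> R := avec e self_int (x 0).

Lemma dual_coordE x w : dual_coord x w = - (x *m M) 0 w.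
Proof.
have ME v : M v w = if v == w then (b v)%:~R else (e v w)%:R by rewrite mxE.
rewrite /dual_coord /avec mxE [X in _ = - X](bigD1 w) //= ME eqxx opprD /self_int mulNr mulrC.
congr (_ - _); rewrite big_mkcond [RHS]big_mkcond; apply: eq_bigr => v _.
rewrite ME; case: eqVneq => [->|_] /=; first by rewrite e_irr.
by rewrite e_sym; case: (e v w); rewrite ?mulr1 ?mulr0.
Qed.

Lemma dual_coordD x y w : dual_coord (x + y) w = dual_coord x w + dual_coord y w.
Proof. by rewrite !dual_coordE mulmxDl mxE opprD. Qed.

Lemma dual_coordN x w : dual_coord (- x) w = - dual_coord x w.
Proof. by rewrite !dual_coordE mulNmx mxE. Qed.

Lemma dual_coordB x y w : dual_coord (x - y) w = dual_coord x w - dual_coord y w.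
Proof. by rewrite dual_coordD dual_coordN. Qed.

Lemma dual_coordZ t x w : dual_coord (t *: x) w = t * dual_coord x w.
Proof. by rewrite !dual_coordE -scalemxAl mxE mulrN. Qed.

Lemma iform_basis x w : iform e b x (basis_vec R w) = - dual_coord x w.
Proof.
rewrite dual_coordE opprK /iform /basis_vec trmx_delta -/M.
by rewrite -colE mxE.
Qed.

Lemma intersection_unit : M \in unitmx.
Proof.
rewrite -row_free_unit -kermx_eq0; apply/eqP/row_matrixP => i; rewrite row0.
apply/eqP; apply: contraT => /hneg.
by rewrite /iform -row_mul mulmx_ker row0 mul0mx mxE ltxx.
Qed.

Lemma sum_EstarE (a : 'I_n -> R) :
  \sum_v a v *: Estar R e b v = - ((\row_v a v) *m invmx M).
Proof.
rewrite mulmx_sum_row -sumrN; apply: eq_bigr => v _.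
by rewrite /Estar scalerN mxE.
Qed.

Lemma dual_coord_sum (a : 'I_n -> R) w : dual_coord (\sum_v a v *: Estar R e b v) w = a w.
Proof.
by rewrite sum_EstarE dual_coordN dual_coordE opprK mulmxKV ?intersection_unit // mxE.
Qed.

Lemma dual_coord_inj x y : dual_coord x =1 dual_coord y -> x = y.
Proof.
move=> xy; rewrite -[x](mulmxK intersection_unit) -[y](mulmxK intersection_unit).
congr (_ *m _); apply/rowP => w; apply: oppr_inj.
by have := xy w; rewrite !dual_coordE.
Qed.

Lemma sum_dual_coord x : \sum_v dual_coord x v *: Estar R e b v = x.
Proof. by apply: dual_coord_inj => w; rewrite dual_coord_sum. Qed.

(** Antinef vectors are effective. *)
Lemma antinef_ge0 x : (forall v, 0 <= dual_coord x v) -> forall v, 0 <= x 0 v.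
Proof.
move=> ax v.
(* With x = pos - neg for the positive and negative parts, (neg, neg) would be
   nonnegative unless neg = 0. *)
pose neg : 'rV[R]_n := \row_v Num.max (- x 0 v) 0.
suff neg0 : neg = 0.
  have := congr1 (fun y : 'rV[R]_n => y 0 v) neg0; rewrite !mxE /= => h.
  have : - x 0 v <= Num.max (- x 0 v) 0 by rewrite le_max lexx.
  by rewrite h oppr_le0.
apply/eqP; apply: contraT => /hneg; rewrite ltNge => /negP[].
have iE y z : iform e b y z = - \sum_w dual_coord y w * z 0 w.
  rewrite /iform mxE -sumrN; apply: eq_bigr => w _.
  by rewrite dual_coordE mulNr opprK [z^T _ _]mxE.
pose pos : 'rV[R]_n := x + neg.
have negE : neg = pos - x by rewrite /pos addrC addKr.
rewrite {1}negE iE oppr_ge0 -/M.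
rewrite (eq_bigr (fun w => dual_coord pos w * neg 0 w - dual_coord x w * neg 0 w)); last first.
  by move=> w _; rewrite dual_coordB mulrBl.
rewrite sumrB subr_le0; apply: (@le_trans _ _ 0); last first.
  by apply: sumr_ge0 => w _; rewrite mulr_ge0 // mxE le_max lexx orbT.
apply: sumr_le0 => w _; rewrite /dual_coord /avec mulrBl.
have pw0 : pos 0 w * neg 0 w = 0.
  rewrite !mxE; case: (leP (- x 0 w) 0) => _; first by rewrite mulr0.
  by rewrite subrr mul0r.
rewrite -mulrA pw0 mulr0 sub0r oppr_le0 mulr_ge0 //; last by rewrite mxE le_max lexx orbT.
apply: sumr_ge0 => u _; rewrite !mxE; case: (leP (- x 0 u) 0) => xu.
  by rewrite addr0 -oppr_le0.
by rewrite subrr.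
Qed.

(** The sum of the E_v^*, which is antinef with all dual coordinates 1. *)
Definition rho : 'rV[R]_n := \sum_v 1 *: Estar R e b v.

Lemma dual_coord_rho v : dual_coord rho v = 1.
Proof. exact: dual_coord_sum. Qed.

Lemma rho_gt0 v : 0 < rho 0 v.
Proof.
have r0 : forall w, 0 <= rho 0 w by apply: antinef_ge0 => w; rewrite dual_coord_rho.
rewrite lt_neqAle r0 andbT; apply/eqP => r0v.
have := dual_coord_rho v; rewrite /dual_coord /avec -r0v mulr0 sub0r => h.
have : 0 <= \sum_(w | e v w) rho 0 w by apply: sumr_ge0 => w _.
by rewrite -oppr_le0 h ler10.
Qed.

Lemma dual_latticeP x : dual_lattice e b x <-> forall v, dual_coord x v \is a Num.int.
Proof.
by split=> h v; have := h v; rewrite iform_basis rpredN.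
Qed.

Lemma real_coneP x : real_cone e b x <-> forall v, 0 <= dual_coord x v.
Proof.
split=> [[a a0 ->] v|h]; first by rewrite dual_coord_sum.
by exists (dual_coord x) => //; rewrite sum_dual_coord.
Qed.

Lemma lattice_dual (x : 'rV[R]_n) : lattice x -> dual_lattice e b x.
Proof.
move=> xL; apply/dual_latticeP => v; rewrite /dual_coord /avec rpredB //.
  by rewrite rpredM // rpredN intr_int.
by apply: rpred_sum => w _; apply: xL.
Qed.

Lemma conn_setT : conn e [set: 'I_n]%SET.
Proof.
move=> v w _ _; apply: connect_sub (e_conn v w) => x y exy.
by apply: connect1; rewrite /induced exy !finset.in_setT.
Qed.

Lemma self_int_gt0 v : 0 < self_int v.
Proof.
have l0 w : 0 < dual_coord rho w by rewrite dual_coord_rho.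
exact: (dominates_gt0 (ls := rho 0) rho_gt0 l0 (@dominates_setT _ _ e self_int)
  (finset.in_setT v)).
Qed.

Lemma nb_setT v : nb e [set: 'I_n]%SET v = valency e v.
Proof.
rewrite /nb /valency -sum1_card; apply: eq_bigl => w.
by rewrite finset.in_setT inE.
Qed.

(* A class of H is represented by its vector r in the unit cube; the members
   of the class are the r + k with k integral. *)
Section Class.
Variable r : 'rV[R]_n.
Hypothesis r_dual : dual_lattice e b r.
Hypothesis r_ge0 : forall v, 0 <= r 0 v.
Hypothesis r_lt1 : forall v, r 0 v < 1.

(** The dual coordinates of r, which are integers. *)
Definition offset v : int := Num.floor (dual_coord r v).

Lemma offsetE v : (offset v)%:~R = dual_coord r v.
Proof. by apply: floorK; apply/dual_latticeP: v. Qed.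

(** The kernel at v before any elimination: the argument of ramp is the dual
    coordinate at v of r + k, with N the sum of k over the neighbours of v. *)
Definition kernel v (k N : nat) : int := ramp (offset v - b v * k%:Z - N%:Z).

(** A bound for the support of kernel v k. *)
Definition kbound v (k : nat) : nat := (`|offset v| + `|b v| * k).+1.

Lemma kernel_bounded T : bounded kbound T kernel.
Proof. by move=> v _ k N; rewrite /kbound /kernel => le_N; apply: ramp_lt0; nia. Qed.

Lemma kernel_arg v k N : (offset v - b v * k%:Z - N%:Z)%:~R =
  self_int v * (k%:R + r 0 v) - (\sum_(w | e v w) r 0 w + N%:R) :> R.
Proof.
rewrite !intrB intrM offsetE /dual_coord /avec /self_int !mulNr mulrDr.
by rewrite -!pmulrn; ring.
Qed.

(** The invariants hold before any elimination, with the thresholds x_v - r_v,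
    when x lies in the translated antinef cone. *)
Lemma kernel_regular (x : 'rV[R]_n) : (forall v, (valency e v)%:R - 1 <= dual_coord x v) ->
  regular e self_int kbound (r 0) (fun v => x 0 v - r 0 v) [set: 'I_n]%SET self_int kernel.
Proof.
move=> xc; have sumT (F : 'I_n -> R) v :
    \sum_(w in [set: 'I_n]%SET | e v w) F w = \sum_(w | e v w) F w.
  by under eq_bigl do rewrite finset.in_setT.
split.
- exact: dominates_setT.
- exact: kernel_bounded.
- move=> v _ _ k N _; rewrite sumT nb_setT sumrB => ge0.
  have {ge0} : 0 <= (offset v - b v * k%:Z - N%:Z)%:~R :> R.
    have := xc v; rewrite kernel_arg /dual_coord /avec.
    by move: ge0; rewrite !mulrBr mulrDr; lra.
  rewrite ler0z => z0; rewrite /diff /kernel ramp_ge0 //.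
  have [z1|z1] := leP 1 (offset v - b v * k%:Z - N%:Z).
    rewrite ramp_ge0; lia.
  rewrite ramp_lt0; lia.
- move=> v _ k N; rewrite sumT -subr_ge0 -kernel_arg ler0z leNgt.
  by apply: contra_neqN => /ramp_lt0.
- move=> v _; exists 1%N, `|b v|%N; have := self_int_gt0 v.
  rewrite /self_int oppr_gt0 ltrz0 => bv; split=> //.
    by rewrite mulr1 -mulrNz -ltz0_abs // pmulrn.
  move=> k N; rewrite /kernel; congr ramp; rewrite !PoszD ltz0_abs //; ring.
Qed.

Lemma kernel_weight (z : 'I_n -> int) (k : 'I_n -> nat) :
  (forall v, (z v)%:~R = dual_coord (r + \row_w (k w)%:R) v) ->
  weight e [set: 'I_n]%SET kernel k = \prod_v tcoef (valency e v) (z v).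
Proof.
move=> zE; rewrite /weight; under [LHS]eq_bigl do rewrite finset.in_setT.
apply: eq_bigr => v _.
rewrite diff_ramp nb_setT; congr tcoef; apply/eqP; rewrite -(eqr_int R) zE kernel_arg.
rewrite dual_coordD /dual_coord /avec mxE natr_sum.
under eq_bigl do rewrite finset.in_setT.
under [X in _ + (_ - X)]eq_bigr do rewrite mxE.
by apply/eqP; ring.
Qed.

(** The E_v^* being a basis, at most one family of exponents a contributes to
    the coefficient at x. *)
Lemma zeta_coefE (x : 'rV[R]_n) (z : 'I_n -> int) :
  (forall v, (z v)%:~R = dual_coord x v) ->
  zeta_coef e b x = \prod_v tcoef (valency e v) (z v).
Proof.
move=> zE; rewrite /zeta_coef.
have xP (a : {ffun 'I_n -> nat}) :
    \sum_v (a v)%:R *: Estar R e b v = x <-> forall v, z v = (a v)%:Z.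
  split=> [ax v|za].
    by apply/eqP; rewrite -(eqr_int R) zE -ax dual_coord_sum pmulrn.
  by apply: dual_coord_inj => v; rewrite dual_coord_sum -zE za pmulrn.
have [z0|/forallPn[v zv]] := boolP [forall v, 0 <= z v].
  have zN v : z v = `|z v|%N by have := forallP z0 v; lia.
  rewrite (_ : [set a | _]%classic = [set [ffun v => `|z v|%N]]%classic).
    rewrite fsbig_set1; apply: eq_bigr => v _.
    by rewrite ffunE {2}zN.
  apply/seteqP; split=> a /=.
    by move=> /xP za; apply/ffunP => v; rewrite ffunE za.
  by move=> ->; apply/xP => v; rewrite ffunE.
rewrite (bigD1 v) //= (_ : tcoef _ _ = 0) ?mul0r; last first.
  by move: zv; rewrite /tcoef; case: (z v).
by apply: fsbig1 => a /= /xP za; rewrite za in zv.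
Qed.

(** The counting function as a sum over a box of exponents k, where
    l' = r + k. *)
Lemma countingE (I : {set 'I_n}) (x : 'rV[R]_n) B :
  (forall k, weight e [set: 'I_n]%SET kernel k != 0 ->
     some_below (fun v => x 0 v - r 0 v) I k -> forall v, (k v <= B)%N) ->
  counting e b I (class_of r) x =
  bsum B [set: 'I_n]%SET (fun k => weight e [set: 'I_n]%SET kernel k *
    (some_below (fun v => x 0 v - r 0 v) I k)%:R).
Proof.
move=> supp.
pose pt (k : {ffun 'I_n -> 'I_B.+1}) : 'rV[R]_n := r + \row_w (k w)%:R.
have pt_inj : injective pt.
  move=> k k' /addrI /rowP kk'; apply/ffunP => v; apply: val_inj.
  by have := kk' v; rewrite !mxE => /eqP; rewrite eqr_nat => /eqP.
have condP (k : 'I_n -> nat) : ~ coord_le (proj I x) (proj I (r + \row_w (k w)%:R)) <->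
    some_below (fun v => x 0 v - r 0 v) I k.
  split=> [|/existsP[v /andP[vI]]].
    move=> /existsNP[v]; rewrite !mxE; case: ifP => [vI|_]; last by rewrite lexx.
    move=> /negP; rewrite -ltNge => lt_v; apply/existsP; exists v.
    by rewrite vI /below ltrBrDr addrC.
  rewrite /below ltrBrDr addrC ltNge => /negP lt_v /(_ v).
  by rewrite !mxE vI.
have row_lat (k : 'I_n -> nat) : lattice (\row_w (k w)%:R : 'rV[R]_n).
  by move=> v; rewrite mxE natr_int.
have pt_dual (k : 'I_n -> nat) : dual_lattice e b (r + \row_w (k w)%:R).
  apply/dual_latticeP => v; rewrite dual_coordD rpredD //.
    exact: (dual_latticeP _).1 r_dual v.
  exact: (dual_latticeP _).1 (lattice_dual (row_lat k)) v.
have classE (y : 'rV[R]_n) : lattice (y - r) -> class_of y = class_of r.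
  move=> yr; apply/seteqP; split=> z /= zy v.
    have -> : (z - r) 0 v = (z - y) 0 v + (y - r) 0 v by rewrite !mxE; ring.
    by apply: rpredD; [apply: zy | apply: yr].
  have -> : (z - y) 0 v = (z - r) 0 v - (y - r) 0 v by rewrite !mxE; ring.
  by apply: rpredB; [apply: zy | apply: yr].
have wE (k : 'I_n -> nat) : zeta_coef e b (r + \row_w (k w)%:R) = weight e [set: 'I_n]%SET kernel k.
  pose z v := Num.floor (dual_coord (r + \row_w (k w)%:R) v).
  have zE v : (z v)%:~R = dual_coord (r + \row_w (k w)%:R) v.
    by apply: floorK; apply: (dual_latticeP _).1 (pt_dual k) v.
  by rewrite (zeta_coefE zE) (kernel_weight zE).
pose rs := [seq pt k | k <- [seq k : {ffun 'I_n -> 'I_B.+1} <- enum {: {ffun 'I_n -> 'I_B.+1}} |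
  some_below (fun v => x 0 v - r 0 v) I (fun v => k v)]].
have rsA l : l \in rs -> [/\ dual_lattice e b l, class_of l = class_of r
    & ~ coord_le (proj I x) (proj I l)].
  move=> /mapP[k]; rewrite mem_filter => /andP[/condP km _] ->; split=> //.
    exact: (pt_dual (fun v => k v)).
  by apply: classE; rewrite /pt addrC addKr; apply: (row_lat (fun v => k v)).
rewrite /counting (fsbigE rs); first last.
- move=> l [ld lh lc] /negP lrs; apply/eqP/negPn/negP => nz.
  have lr : lattice (l - r).
    have : class_of r l by rewrite -lh => v; rewrite subrr mxE rpred0.
    by [].
  pose z v := Num.floor (dual_coord l v).
  have zE v : (z v)%:~R = dual_coord l v by apply: floorK; apply: (dual_latticeP _).1 ld v.
  have z0 v : 0 <= z v.
    move: nz; rewrite (zeta_coefE zE) (bigD1 v) //= mulf_eq0 negb_or => /andP[+ _].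
    by case: (z v) => //= m; rewrite eqxx.
  have l0 := antinef_ge0 (fun v => etrans (congr1 _ (esym (zE v))) (etrans (ler0z _ _) (z0 v))).
  pose k (v : 'I_n) := absz (Num.floor (l 0 v - r 0 v)).
  have kE v : (k v)%:R = l 0 v - r 0 v.
    have := lr v; rewrite !mxE => li; rewrite -[RHS](floorK li) /k pmulrn gez0_abs //.
    rewrite -ltzD1 -(ltr_int R) intrD floorK //; have := l0 v; have := r_lt1 v; lra.
  have lE : l = r + \row_w (k w)%:R.
    by apply/rowP => v; rewrite !mxE kE addrC subrK.
  have km : some_below (fun v => x 0 v - r 0 v) I k by apply/condP; rewrite -lE.
  have kB v : (k v <= B)%N by apply: supp => //; rewrite -wE -lE.
  apply: lrs; apply/mapP; exists [ffun v => inord (k v)].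
    rewrite mem_filter mem_enum andbT (_ : (fun v => _) = k) //.
    by apply: funext => v; rewrite ffunE inordK // ltnS.
  by rewrite lE; congr (_ + _); apply/rowP => v; rewrite !mxE ffunE inordK // ltnS.
- by move=> l /= /rsA.
- by rewrite map_inj_uniq // filter_uniq // enum_uniq.
rewrite big_seq_cond (eq_bigl (fun l => l \in rs)); last first.
  by move=> l; case: (boolP (l \in rs)) => //= /rsA lA; apply: mem_set.
rewrite -big_seq /rs big_map big_filter big_enum_cond /= /bsum big_mkcond [RHS]big_mkcond.
apply: eq_bigr => k _; rewrite /pt (wE (fun v => k v)).
have -> : [forall v, (v \notin [set: 'I_n]%SET) ==> (k v == ord0)].
  by apply/forallP => v; rewrite finset.in_setT.
by case: (some_below _ _ _); rewrite ?mulr1 ?mulr0.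
Qed.

Lemma weight_neighbour k v w : weight e [set: 'I_n]%SET kernel k != 0 -> e v w ->
  (k w < kbound v (k v))%N.
Proof.
move=> nz evw; apply: (@leq_ltn_trans (nsum e [set: 'I_n]%SET k v)).
  by rewrite /nsum (bigD1 w) ?finset.in_setT //= leq_addr.
rewrite ltnNge; apply: contra_neqN nz => le_N.
rewrite /weight (bigD1 v) ?finset.in_setT //= (@diff_iter0 _ _ (kbound v (k v))) ?mul0r //.
by move=> N; apply: (kernel_bounded (T := [set: 'I_n]%SET)); rewrite finset.in_setT.
Qed.

(** In the support of the weight, a bound on one exponent bounds them all. *)
Lemma weight_bound X : exists B, forall v k, weight e [set: 'I_n]%SET kernel k != 0 ->
  (k v < X)%N -> forall w, (k w <= B)%N.
Proof.
have bnd (vw : 'I_n * 'I_n) : exists B, forall k, weight e [set: 'I_n]%SET kernel k != 0 ->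
    (k vw.1 < X)%N -> (k vw.2 <= B)%N.
  case: vw => v w /=; have /connectP[s] := e_conn v w.
  elim/last_ind: s w => [|s x IHs] w /=; first by move=> _ ->; exists X => k _ /ltnW.
  rewrite rcons_path last_rcons => /andP[ps ex] ->.
  have [B BP] := IHs _ ps erefl.
  exists (\max_(i < B.+1) kbound (last v s) i)%N => k nz kX.
  have lB : (k (last v s) < B.+1)%N by rewrite ltnS BP.
  apply: leq_trans (ltnW (weight_neighbour nz ex)) _.
  exact: (leq_bigmax_cond (Ordinal lB)).
have [f fP] := fin_all_exists bnd.
exists (\max_vw f vw)%N => v k nz kX w.
exact: leq_trans (fP (v, w) k nz kX) (leq_bigmax (v, w)).
Qed.

Lemma below_bound (t : 'I_n -> R) : exists B0, forall B, (B0 <= B)%N ->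
  forall v k, weight e [set: 'I_n]%SET kernel k != 0 -> below t k v ->
  forall w, (k w <= B)%N.
Proof.
pose X := \max_v (Num.truncn (t v)).+1.
have [B0 B0P] := weight_bound X; exists B0 => B le_B v k nz kv w.
apply: leq_trans le_B; apply: (B0P v k nz).
apply: (@leq_trans (Num.truncn (t v)).+1); last exact: leq_bigmax.
by rewrite -(ltr_nat R); apply: lt_trans kv (truncnS_gt _).
Qed.

Lemma valency_gt0 : (1 < n)%N -> forall v, (0 < valency e v)%N.
Proof.
move=> n1 v; have [w wv] : exists w : 'I_n, w != v.
  apply/existsP; apply: contraTT n1 => /existsPn h; rewrite -leqNgt.
  rewrite -{1}(card_ord n) -(cards1 v) -cardsT subset_leq_card //.
  by apply/fintype.subsetP => w _; rewrite inE; have := h w; rewrite negbK.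
have [|a [c [eac]]] := connect_exit (e_conn v w) (set11 v); first by rewrite inE.
rewrite inE => /eqP av _; rewrite av in eac; apply/card_gt0P; exists c.
by rewrite inE.
Qed.

Lemma sum_edges (f g : 'I_n -> int) :
  (forall v, g v = (valency e v)%:R) ->
  \sum_(v < n) \sum_(w < n | (v < w)%N && e v w) (f v + f w) = \sum_v g v * f v.
Proof.
move=> gE; under eq_bigr do rewrite big_split /=.
rewrite big_split /= [X in _ + X](exchange_big_dep xpredT) //= -big_split /=.
apply: eq_bigr => v _; rewrite gE /valency -sum1_card natr_sum mulr_suml.
under [RHS]eq_bigr do rewrite mul1r.
rewrite [RHS](bigID (fun w : 'I_n => (v < w)%N)) /=; congr (_ + _).
  by apply: eq_bigl => w; rewrite inE andbC.
apply: eq_big => [w|//]; rewrite inE e_sym andbC -leqNgt ltn_neqAle.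
by case: eqVneq => [/val_inj->|_]; rewrite ?e_irr.
Qed.

(** Both sides are sums over the same box of the weight, multiplied on the left
    by the indicator that some exponent is below its threshold, and on the right
    by the Euler characteristic of the subgraph induced on the vertices with this
    property. *)
Lemma counting_formula (x : 'rV[R]_n) :
  (forall v, (valency e v)%:R - 1 <= dual_coord x v) ->
  counting e b [set: 'I_n]%SET (class_of r) x =
    \sum_(v < n) \sum_(w < n | (v < w)%N && e v w)
       counting e b [set v; w]%SET (class_of r) x
    - \sum_(v < n) ((valency e v)%:Z - 1) * counting e b [set v]%SET (class_of r) x.
Proof.
move=> xc; pose chi v := x 0 v - r 0 v.
have [n1|n1] := leqP n 1.
  (* For a single vertex the thresholds may be below -1, but both sides
     are the counting function at this vertex. *)
  have n0 : (0 < n)%N by case: htree.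
  pose v0 := Ordinal n0.
  have one v : v = v0 by apply: ord_inj; have := ltn_ord v => /=; lia.
  have -> : [set: 'I_n]%SET = [set v0].
    by apply/setP => v; rewrite finset.in_setT inE (one v) eqxx.
  rewrite (bigD1 v0) //= big1 => [|w /andP[]]; last by rewrite (one w) ltnn.
  rewrite big1 => [|v]; last by rewrite (one v) eqxx.
  rewrite (bigD1 v0) //= big1 => [|v]; last by rewrite (one v) eqxx.
  rewrite (_ : valency e v0 = 0%N) ?addr0; last first.
    by apply: eq_card0 => w; rewrite inE (one w) e_irr.
  by rewrite !sub0r mulN1r opprK.
have [B0 B0P] := below_bound chi.
have supp (I : {set 'I_n}) k : weight e [set: 'I_n]%SET kernel k != 0 ->
    some_below chi I k -> forall v, (k v <= B0)%N.
  by move=> nz /existsP[v /andP[_ bv]]; apply: B0P bv.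
have cE (I : {set 'I_n}) : counting e b I (class_of r) x = bsum B0 [set: 'I_n]%SET
    (fun k => weight e [set: 'I_n]%SET kernel k * (some_below chi I k)%:R).
  exact: countingE (supp I).
have chi1 v : -1 < chi v.
  have : 0 <= x 0 v.
    apply: antinef_ge0 => w; apply: le_trans (xc w).
    by rewrite subr_ge0 ler1n valency_gt0.
  by have := r_lt1 v; rewrite /chi; lra.
have al0 w : 0 < dual_coord rho w by rewrite dual_coord_rho.
have [dT bT kT _ _] := kernel_regular xc.
have vT : Ordinal (ltnW n1) \in [set: 'I_n]%SET by rewrite finset.in_setT.
have := below_euler e_sym e_irr e_acyclic rho_gt0 al0 chi1 conn_setT vT dT bT kT
  (fun k nz m v _ => supp _ k nz m v).
rewrite (_ : (fun k => _) = (fun k => weight e [set: 'I_n]%SET kernel k *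
    (some_below chi [set: 'I_n]%SET k)%:R -
    weight e [set: 'I_n]%SET kernel k * euler e chi [set: 'I_n]%SET k)); last first.
  by apply: funext => k; rewrite mulrBr.
rewrite bsumB -cE => /eqP; rewrite subr_eq0 => /eqP ->.
under [X in _ = X - _]eq_bigr do under eq_bigr do rewrite cE.
under [X in _ = _ - X]eq_bigr do rewrite cE /bsum mulr_sumr.
rewrite /bsum [X in _ = _ - X]exchange_big /=.
under [X in _ = X - _]eq_bigr do rewrite exchange_big /=.
rewrite [X in _ = X - _]exchange_big /= -sumrB; apply: eq_bigr => k0 _.
set k : 'I_n -> nat := fun v => k0 v.
under [X in _ = X - _]eq_bigr do rewrite -mulr_sumr.
under [X in _ = _ - X]eq_bigr do rewrite mulrCA.
rewrite -!mulr_sumr -mulrBr; congr (_ * _).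
under [X in _ = X - _]eq_bigr do under eq_bigr do rewrite some_below2.
under [X in _ = _ - X]eq_bigr do rewrite some_below1.
have -> : euler e chi [set: 'I_n]%SET k = \sum_v (below chi k v)%:R -
    \sum_(v < n) \sum_(w < n | (v < w)%N && e v w) (below chi k v && below chi k w)%:R.
  congr (_ - _); first by apply: eq_bigl => v; rewrite finset.in_setT.
  apply: eq_big => [v|v _]; first by rewrite finset.in_setT.
  by apply: eq_bigl => w; rewrite finset.in_setT.
have := @sum_edges (fun v => (below chi k v)%:R) (fun v => (valency e v)%:R) (fun=> erefl).
have -> : \sum_(v < n) \sum_(w < n | (v < w)%N && e v w) ((below chi k v)%:R + (below chi k w)%:R) =
  \sum_(v < n) \sum_(w < n | (v < w)%N && e v w) (below chi k v || below chi k w)%:R +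
  \sum_(v < n) \sum_(w < n | (v < w)%N && e v w) (below chi k v && below chi k w)%:R :> int.
  rewrite -big_split; apply: eq_bigr => v _; rewrite -big_split; apply: eq_bigr => w _.
  by case: (below chi k v); case: (below chi k w).
under [X in _ = _ - X]eq_bigr do rewrite mulrBl mul1r.
rewrite sumrB => h.
have -> : \sum_(v < n) (valency e v)%:Z * (below chi k v)%:R =
  \sum_v (valency e v)%:R * (below chi k v)%:R by apply: eq_bigr => v _; rewrite -[(valency e v)%:Z]natz.
by rewrite -h; ring.
Qed.

(** A vector deep enough in the antinef cone for the exponents above it to be
    in the regular range of the kernels. *)
Definition base : 'rV[R]_n := \sum_v (valency e v)%:R *: Estar R e b v.

Lemma dual_coord_base v : dual_coord base v = (valency e v)%:R.
Proof. exact: dual_coord_sum. Qed.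

Lemma base_regular :
  regular e self_int kbound (r 0) (fun v => base 0 v - r 0 v) [set: 'I_n]%SET self_int kernel.
Proof.
by apply: kernel_regular => v; rewrite dual_coord_base lerBlDr lerDl.
Qed.

Lemma base_gtN1 v : -1 < base 0 v - r 0 v.
Proof.
have : 0 <= base 0 v by apply: antinef_ge0 => w; rewrite dual_coord_base.
by have := r_lt1 v; lra.
Qed.

(** The number of exponents j >= 0 with r_v + j < x_v. *)
Definition height (v : 'I_n) (x : 'rV[R]_n) : nat := absz (xceil (r 0 v) v x).

Lemma lt_height (x : 'rV[R]_n) (v : 'I_n) : 0 <= x 0 v ->
  forall j : nat, (j%:R < x 0 v - r 0 v) = (j < height v x)%N.
Proof.
move=> x0 j; have c0 : 0 <= xceil (r 0 v) v x.
  by rewrite ceil_ge0; have := r_lt1 v; lra.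
by rewrite -ltz_nat gez0_abs // ceil_gt_int.
Qed.

Lemma counting_vertex v : exists g, exists D, exists E, exists c,
  step_kernel g D E c /\ forall x : 'rV[R]_n, 0 <= x 0 v ->
    counting e b [set v]%SET (class_of r) x = ksum g 0 (height v x).
Proof.
have al0 w : 0 < dual_coord rho w by rewrite dual_coord_rho.
have [g [D [E [c [sk gE]]]]] := sum_below_vertex e_sym e_irr e_acyclic rho_gt0 al0
  r_ge0 r_lt1 base_gtN1 conn_setT (finset.in_setT v) base_regular.
exists g, D, E, c; split=> // x x0; set X := height v x.
have [B0 B0P] := below_bound (fun v => x 0 v - r 0 v).
pose B := maxn B0 X; have supp := B0P B (leq_maxl _ _).
rewrite (countingE (B := B)); last first.
  by move=> k nz; rewrite some_below1 => /supp; apply.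
rewrite -(gE (x 0 v - r 0 v) X B); first last.
- by move=> k nz kv w _; apply: (supp v).
- by rewrite leqW // leq_maxr.
- exact: lt_height.
by apply: eq_bigr => k _; rewrite some_below1.
Qed.

(** Below v or below w means below v, or above v and below w. *)
Lemma counting_edge v w : e v w -> exists g, exists D, exists E, exists c,
  [/\ step_kernel g D E c,
    forall l : 'rV[R]_n, (forall u, 0 <= dual_coord l u) ->
      D%:R * (dual_coord l w + l 0 v) <= E%:R * l 0 w &
    forall x l : 'rV[R]_n, (forall u, 0 <= dual_coord l u) ->
      x 0 v = base 0 v + l 0 v -> x 0 w = base 0 w + l 0 w ->
      counting e b [set v; w]%SET (class_of r) x =
      counting e b [set v]%SET (class_of r) x +
      ksum g (height v x) (height w x)].
Proof.
move=> evw; have al0 u : 0 < dual_coord rho u by rewrite dual_coord_rho.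
have [g [D [E [c [sk dom gE]]]]] := sum_below_edge e_sym e_irr e_acyclic rho_gt0 al0
  r_ge0 r_lt1 base_gtN1 conn_setT (finset.in_setT v) (finset.in_setT w) evw base_regular.
exists g, D, E, c; split=> // [l|x l al xv xw]; first exact: (dom (l 0)).
have l0 := antinef_ge0 al.
have base0 u : 0 <= base 0 u by apply: antinef_ge0 => ?; rewrite dual_coord_base.
have xv0 : 0 <= x 0 v by rewrite xv addr_ge0.
have xw0 : 0 <= x 0 w by rewrite xw addr_ge0.
set X := height v x; set Y := height w x.
have [B0 B0P] := below_bound (fun v => x 0 v - r 0 v).
pose B := maxn (maxn B0 X) (maxn Y (\max_(j < Y) kbound w j)).
have supp : forall u k, weight e [set: 'I_n]%SET kernel k != 0 ->
    below (fun v => x 0 v - r 0 v) k u -> forall u', (k u' <= B)%N.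
  by apply: B0P; rewrite /B; lia.
rewrite !(countingE (B := B)); first last.
- by move=> k nz; rewrite some_below2 => /orP[] /supp; apply.
- by move=> k nz; rewrite some_below1 => /supp; apply.
rewrite -(gE (fun u => x 0 u - r 0 u) (l 0) X Y B al l0); first last.
- by move=> k nz kw u _; apply: (supp w).
- move=> j jY; rewrite leqW // /B leq_max; apply/orP; right.
  by rewrite leq_max (leq_bigmax_cond (Ordinal jY)) ?orbT.
- by rewrite /B; lia.
- by rewrite /B; lia.
- exact: lt_height.
- exact: lt_height.
- by rewrite xw; ring.
- by rewrite xv; ring.
rewrite /bsum -big_split; apply: eq_bigr => k _ /=.
rewrite -mulrDr some_below1 some_below2 /below; congr (_ * _).
by case: ltP; case: ltP.
Qed.

(** The points whose coordinates in I are those of a point of the antinef cone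
    translated by m rho. *)
Definition deep (I : {set 'I_n}) (m : nat) (x : 'rV[R]_n) :=
  exists2 l : 'rV[R]_n, forall u, 0 <= dual_coord l u &
    forall v, v \in I -> x 0 v = m%:R * rho 0 v + l 0 v.

Lemma deepS (I J : {set 'I_n}) m m' (x : 'rV[R]_n) : J \subset I -> (m' <= m)%N -> deep I m x -> deep J m' x.
Proof.
move=> JI mm' [l al xl]; exists ((m - m')%:R *: rho + l) => [u|v vJ].
  by rewrite dual_coordD dual_coordZ dual_coord_rho mulr1 addr_ge0.
rewrite (xl v) ?(fintype.subsetP JI) // !mxE natrB //; ring.
Qed.

Lemma exists_multiple (a t : R) : 0 < t -> exists m : nat, a <= m%:R * t.
Proof.
move=> t0; exists (Num.truncn (a / t)).+1.
by rewrite -ler_pdivrMr // ltW // truncnS_gt.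
Qed.

Lemma vertex_quasipoly v : exists q, exists m : nat, [/\ quasipoly q,
  forall x y : 'rV[R]_n, x 0 v = y 0 v -> q x = q y &
  forall x, deep [set v]%SET m x -> q x = (counting e b [set v]%SET (class_of r) x)%:~R].
Proof.
have [g [D [E [c [sk gE]]]]] := counting_vertex v.
have [m mP] := exists_multiple (D * c.+1 + 1)%:R (rho_gt0 v).
exists (fun x => qstep R g D E c 0 (xceil (r 0 v) v x)), m; split.
- by have [_] := quasipoly_qstep sk (r 0 v) (r 0 v) v v; apply.
- by move=> x y xy; rewrite /xceil xy.
move=> x [l al /(_ v (set11 v)) xl]; have l0 := antinef_ge0 al v.
have x0 : 0 <= x 0 v.
  by rewrite xl addr_ge0 // mulr_ge0 // ltW // rho_gt0.
rewrite gE //; have c0 : 0 <= xceil (r 0 v) v x.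
  by rewrite ceil_ge0; have := r_lt1 v; lra.
rewrite -{1}(gez0_abs c0); apply: (qstepE _ sk).
rewrite div0n add0n leq_divRL ?(step_D sk) // mulnC.
rewrite -/(height v x) -(prednK (_ : 0 < D * c.+1)%N) ?muln_gt0 ?(step_D sk) //.
rewrite -lt_height //.
have : ((D * c.+1).-1)%:R <= (D * c.+1)%:R :> R by rewrite ler_nat leq_pred.
by move: mP; rewrite natrD xl; have := r_lt1 v; lra.
Qed.

Lemma edge_quasipoly v w : e v w -> exists q, exists m : nat, [/\ quasipoly q,
  forall x y : 'rV[R]_n, x 0 v = y 0 v -> x 0 w = y 0 w -> q x = q y &
  forall x, deep [set v; w]%SET m x ->
    q x = (counting e b [set v; w]%SET (class_of r) x)%:~R].
Proof.
move=> evw; have [q1 [m1 [q1P q1l q1E]]] := vertex_quasipoly v.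
have [g [D [E [c [sk dom gE]]]]] := counting_edge evw.
pose m := maxn m1 (maxn n (1 + E + c.+2 * E)).
exists (fun x => q1 x + qstep R g D E c (xceil (r 0 v) v x) (xceil (r 0 w) w x)), m.
split.
- by apply: quasipolyD => //; have [] := quasipoly_qstep sk (r 0 v) (r 0 w) v w.
- by move=> x y xyv xyw; rewrite (q1l x y) // /xceil xyv xyw.
move=> x xdeep; rewrite q1E; last first.
  apply: deepS xdeep; last by rewrite /m; lia.
  by apply/fintype.subsetP => u; rewrite !inE => ->.
have [l al xl] := xdeep.
have xlv : x 0 v = m%:R * rho 0 v + l 0 v by apply: xl; rewrite !inE eqxx.
have xlw : x 0 w = m%:R * rho 0 w + l 0 w by apply: xl; rewrite !inE eqxx orbT.
pose l1 : 'rV[R]_n := m%:R *: rho + l.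
have al1 u : m%:R <= dual_coord l1 u.
  by rewrite dual_coordD dual_coordZ dual_coord_rho mulr1 lerDl.
have xv1 : x 0 v = l1 0 v by rewrite !mxE.
have xw1 : x 0 w = l1 0 w by rewrite !mxE.
have l10 u : 0 <= l1 0 u by apply: antinef_ge0 => ?; apply: le_trans (al1 _).
rewrite (gE x (l1 - base)); first last.
- by rewrite xw1 !mxE; ring.
- by rewrite xv1 !mxE; ring.
- move=> u; rewrite dual_coordB dual_coord_base subr_ge0; apply: le_trans (al1 u).
  rewrite ler_nat; apply: leq_trans (max_card _) _.
  by rewrite card_ord /m; lia.
rewrite intrD; congr (_ + _).
have cv0 : 0 <= xceil (r 0 v) v x.
  by rewrite ceil_ge0; have := r_lt1 v; have := l10 v; lra.
have cw0 : 0 <= xceil (r 0 w) w x.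
  by rewrite ceil_ge0; have := r_lt1 w; have := l10 w; lra.
rewrite -{1}(gez0_abs cv0) -{1}(gez0_abs cw0); apply: (qstepE _ sk).
set N := height v x; set Y := height w x.
suff : (D * N + c.+2 * (D * E) <= E * Y)%N.
  have [D0 E0] := (step_D sk, step_E sk); rewrite leq_divRL // => h.
  have hN : (D * (N %/ E * E) <= D * N)%N by rewrite leq_mul2l leq_divM orbT.
  rewrite leqNgt; apply/negP => Yq.
  have {Yq} : (E * Y < E * ((N %/ E + c.+1) * D))%N by rewrite ltn_pmul2l.
  by move: (N %/ E)%N hN => q; rewrite /N /Y; lia.
rewrite -(ler_nat R) natrD !natrM.
have N1 : N%:R - 1 < x 0 v.
  have := ceilB1_lt (x 0 v - r 0 v); rewrite -[Num.ceil _]/(xceil (r 0 v) v x).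
  by rewrite -(gez0_abs cv0) intrB -/N -[N%:Z%:~R]/(N%:R); have := r_ge0 v; lra.
have Y1 : x 0 w - 1 < Y%:R.
  have := ceil_ge (x 0 w - r 0 w); rewrite -[Num.ceil _]/(xceil (r 0 w) w x).
  by rewrite -(gez0_abs cw0) -/Y -[Y%:Z%:~R]/(Y%:R); have := r_lt1 w; lra.
have := dom l1 (fun u => le_trans (ler0n _ _) (al1 u)); rewrite -xv1 -xw1 => h.
have D1 : 1 <= D%:R :> R by rewrite ler1n (step_D sk).
have E0 : 0 <= E%:R :> R by [].
have mE : 1 + E%:R + c.+2%:R * E%:R <= m%:R :> R.
  by rewrite -[1]/(1%:R) -natrM -!natrD ler_nat /m; lia.
have h1 : D%:R * (m%:R + x 0 v) <= E%:R * x 0 w.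
  by apply: le_trans h; rewrite ler_pM2l ?(lt_le_trans ltr01) // lerD2r.
have h2 : E%:R * (x 0 w - 1) <= E%:R * Y%:R by rewrite ler_wpM2l // ltW.
have h3 : D%:R * (N%:R - 1) <= D%:R * x 0 v.
  by rewrite ler_wpM2l ?(le_trans ler01) // ltW.
have h4 : D%:R * (1 + E%:R + c.+2%:R * E%:R) <= D%:R * m%:R :> R.
  by rewrite ler_wpM2l ?(le_trans ler01).
have h5 : E%:R <= D%:R * E%:R :> R by rewrite ler_peMl.
by move: h1 h2 h3 h4 h5; lra.
Qed.


End Class.

Lemma class_representative h : discriminant_group e b h -> exists r : 'rV[R]_n,
  [/\ dual_lattice e b r, forall v, 0 <= r 0 v, forall v, r 0 v < 1 & h = class_of r].
Proof.
case=> y yd <-; exists (\row_v (y 0 v - (Num.floor (y 0 v))%:~R)).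
set r := \row_v _; have yr : lattice (y - r).
  by move=> v; rewrite !mxE opprB addrCA subrr addr0 intr_int.
split.
- have -> : r = y - (y - r) by rewrite opprB addrCA subrr addr0.
  apply/dual_latticeP => v; rewrite dual_coordB rpredB //; first exact: (dual_latticeP y).1.
  exact: (dual_latticeP _).1 (lattice_dual yr) v.
- by move=> v; rewrite mxE subr_ge0 floor_le.
- by move=> v; rewrite mxE ltrBlDl; have := floorD1_gt (y 0 v); rewrite intrD.
apply/seteqP; split=> z /= zy v.
  have -> : (z - r) 0 v = (z - y) 0 v + (y - r) 0 v by rewrite !mxE; ring.
  by apply: rpredD; [apply: zy | apply: yr].
have -> : (z - y) 0 v = (z - r) 0 v - (y - r) 0 v by rewrite !mxE; ring.
by apply: rpredB; [apply: zy | apply: yr].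
Qed.

Lemma dual_lattice0 : dual_lattice e b (0 : 'rV[R]_n).
Proof.
by apply/dual_latticeP => v; rewrite -(subrr 0) dual_coordB subrr rpred0.
Qed.

Lemma dual_latticeB (x y : 'rV[R]_n) :
  dual_lattice e b x -> dual_lattice e b y -> dual_lattice e b (x - y).
Proof.
move=> xd yd; apply/dual_latticeP => v; rewrite dual_coordB rpredB //.
  exact: (dual_latticeP _).1 xd v.
exact: (dual_latticeP _).1 yd v.
Qed.

Lemma projB (I : {set 'I_n}) (x y : 'rV[R]_n) : proj I (x - y) = proj I x - proj I y.
Proof. by apply/rowP => v; rewrite !mxE; case: ifP; rewrite ?subr0. Qed.

(** Cramer's rule: the determinant annihilates L'/L. *)
Lemma Estar_multiple : exists2 d : nat, (0 < d)%N &
  forall v u, d%:R * Estar R e b v 0 u \is a Num.int.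
Proof.
pose Mi : 'M[int]_n := \matrix_(v, w) (if v == w then b v else (e v w)%:R).
have ME : M = map_mx intr Mi.
  by apply/matrixP => v w; rewrite !mxE; case: eqP => // _; case: (e v w).
have dM : \det M = (\det Mi)%:~R by rewrite ME det_map_mx.
have d0 : \det M != 0 by rewrite -unitfE; apply: intersection_unit.
exists `|\det Mi|%N; first by rewrite absz_gt0 -(intr_eq0 R) -dM.
move=> v u; rewrite /Estar -/M /invmx intersection_unit !mxE.
have -> : cofactor M u v = (cofactor Mi u v)%:~R.
  by rewrite ME cofactor_map_mx.
rewrite mulrN rpredN mulrA rpredM ?intr_int // natr_absz dM intr_norm.
case: (ger0P (_%:~R : R)) => _; last rewrite mulNr rpredN.
  by rewrite divff -?dM // rpred1.
by rewrite divff -?dM // rpred1.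
Qed.

(** The vectors of pi_I(L') with all coordinates in m Z. *)
Definition coord_multiple (I : {set 'I_n}) (m : nat) : set 'rV[R]_n :=
  [set x | (proj I @` dual_lattice e b) x /\
    forall v, exists z : int, x 0 v = m%:R * z%:~R]%classic.

Lemma proj_dualB (I : {set 'I_n}) (x y : 'rV[R]_n) :
  (proj I @` dual_lattice e b)%classic x -> (proj I @` dual_lattice e b)%classic y ->
  (proj I @` dual_lattice e b)%classic (x - y).
Proof.
move=> [x' xd <-] [y' yd <-]; exists (x' - y'); last exact: projB.
exact: dual_latticeB.
Qed.

Lemma proj_dual0 (I : {set 'I_n}) : (proj I @` dual_lattice e b)%classic (0 : 'rV[R]_n).
Proof.
exists 0; first exact: dual_lattice0.
by apply/rowP => v; rewrite !mxE; case: ifP.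
Qed.

Lemma coord_multiple_finite (I : {set 'I_n}) m : (0 < m)%N ->
  finite_index_sublattice (coord_multiple I m) (proj I @` dual_lattice e b)%classic.
Proof.
move=> m0; have [d d0 dE] := Estar_multiple; split; first by move=> x [].
  split.
    by split; [exact: proj_dual0 | move=> v; exists 0; rewrite mxE mulr0].
  move=> x y [xp xm] [yp ym]; split; first exact: proj_dualB.
  move=> v; have [z zE] := xm v; have [z' zE'] := ym v; exists (z - z').
  by rewrite !mxE zE zE' intrB mulrBr.
have dm0 : (0 < d * m)%N by rewrite muln_gt0 d0.
pose rep (i : {ffun 'I_n -> 'I_(d * m)}) : 'rV[R]_n :=
  \sum_v (i v)%:R *: Estar R e b v.
exists [seq proj I (rep i) | i <- enum {: {ffun 'I_n -> 'I_(d * m)}}] => x [l ld <-].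
pose z v := Num.floor (dual_coord l v).
have zE v : (z v)%:~R = dual_coord l v by apply: floorK; apply: (dual_latticeP _).1 ld v.
have modP v : (`|(z v %% (d * m)%:Z)%Z| < d * m)%N.
  by rewrite -ltz_nat gez0_abs ?modz_ge0 ?ltz_pmod // -lt0n.
pose i := [ffun v => Ordinal (modP v)].
exists (proj I (rep i)); first by apply/map_f/mem_enum.
have dual_rep : dual_lattice e b (rep i).
  by apply/dual_latticeP => v; rewrite dual_coord_sum natr_int.
split; first by apply: proj_dualB; [exists l | exists (rep i)].
move=> v; rewrite -projB mxE; case: ifP => _; last by exists 0; rewrite mulr0.
have -> : l - rep i = \sum_u ((z u %/ (d * m)%:Z)%Z%:~R * (d * m)%:R) *: Estar R e b u.
  apply: dual_coord_inj => u; rewrite dual_coordB !dual_coord_sum ffunE /= -zE.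
  rewrite {1}(divz_eq (z u) (d * m)%:Z) intrD intrM natr_absz ger0_norm ?addrK //.
  by rewrite modz_ge0 // -lt0n.
exists (\sum_u (z u %/ (d * m)%:Z)%Z * Num.floor (d%:R * Estar R e b u 0 v)).
rewrite summxE rmorph_sum /= mulr_sumr; apply: eq_bigr => u _.
by rewrite mxE intrM floorK // natrM; ring.
Qed.

Lemma quasipoly_on (I : {set 'I_n}) (q : 'rV[R]_n -> R) : quasipoly q ->
  quasipolynomial_on (proj I @` dual_lattice e b)%classic q.
Proof.
move=> [m m0 qP]; exists (coord_multiple I m); first exact: coord_multiple_finite.
move=> y _; have [P qE] := qP y; exists P => x [_ xy]; apply: qE => v.
by have [z] := xy v; rewrite !mxE; exists z.
Qed.

(** A quasipolynomial in the coordinates in I that agrees with the counting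
    function deep in the cone computes the periodic constant. *)
Lemma quasipoly_pc (I : {set 'I_n}) h (q : 'rV[R]_n -> R) m : quasipoly q ->
  (forall x y : 'rV[R]_n, (forall v, v \in I -> x 0 v = y 0 v) -> q x = q y) ->
  (forall x, deep I m x -> q x = (counting e b I h x)%:~R) ->
  is_periodic_constant e b I h (q 0).
Proof.
move=> qP ql qE; exists (proj I @` dual_lattice e b)%classic, (proj I (m%:R *: rho)), q.
split=> //.
- split=> //; first by split; [exact: proj_dual0 | exact: proj_dualB].
  by exists [:: 0] => x xp; exists 0; rewrite ?inE ?subr0.
- exists (m%:R *: rho) => //; apply/real_coneP => v.
  by rewrite dual_coordZ dual_coord_rho mulr1.
- exact: quasipoly_on.
move=> x _ [l /real_coneP al lx]; apply: qE; exists l => // v vI.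
have := congr1 (fun y : 'rV[R]_n => y 0 v) lx; rewrite !mxE vI => ->.
by rewrite addrCA subrr addr0.
Qed.

(** ** Uniqueness of the periodic constant *)

(** A polynomial restricted to a line through the origin. *)
Lemma meval_line (P : mpoly.mpoly n R) (w : 'I_n -> R) : exists p : {poly R},
  forall t, mpoly.meval (fun v => t * w v) P = p.[t].
Proof.
elim/mpoly.mpolyind: P => [|c m P _ _ [p pE]].
  by exists 0 => t; rewrite mpoly.meval0 horner0.
exists (c *: \prod_(i < n) (w i *: 'X) ^+ mpoly.fun_of_multinom m i + p) => t.
rewrite mpoly.mevalD mpoly.mevalZ mpoly.mevalX pE hornerD hornerZ horner_prod.
congr (_ * _ + _); apply: eq_bigr => i _.
by rewrite horner_exp hornerZ hornerX mulrC.
Qed.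

Lemma poly_eventually_eq (p p' : {poly R}) t0 :
  (forall t : nat, (t0 <= t)%N -> p.[t%:R] = p'.[t%:R]) -> p = p'.
Proof.
move=> pp; apply/eqP; rewrite -subr_eq0; apply: contraT => nz.
pose rs : seq R := [seq (t0 + i)%:R | i <- iota 0 (size (p - p'))].
have : (size rs < size (p - p')%R)%N.
  apply: max_poly_roots => //.
    apply/allP => _ /mapP[i _ ->]; rewrite /root hornerD hornerN pp ?leq_addr //.
    by rewrite subrr.
  rewrite map_inj_uniq ?iota_uniq // => i j /eqP.
  by rewrite eqr_nat eqn_add2l => /eqP.
by rewrite size_map size_iota ltnn.
Qed.

(** Two of the multiples of y lie in the same class, by the pigeonhole
    principle. *)
Lemma finite_index_multiple (K Lam : set 'rV[R]_n) y : finite_index_sublattice K Lam ->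
  (forall i : nat, Lam (i%:R *: y)) -> exists2 j : nat, (0 < j)%N & K (j%:R *: y).
Proof.
move=> [_ [_ Ksub] [s sP]] Ly.
have fE (i : 'I_(size s).+1) : exists j : 'I_(size s), K ((i : nat)%:R *: y - s`_j).
  have [z zs Kz] := sP _ (Ly i); have zi : (index z s < size s)%N by rewrite index_mem.
  by exists (Ordinal zi); rewrite nth_index.
have [f fP] := fin_all_exists fE.
have /injectivePn[i [j ij fij]] : ~~ injectiveb f.
  by apply/negP => /injectiveP/leq_card; rewrite !card_ord ltnn.
wlog lt_ij : i j ij fij / (j < i)%N.
  move=> H; have [ij'|ji|/val_inj ij'] := ltngtP i j.
  - by apply: (H j i) => //; rewrite eq_sym.
  - exact: (H i j).
  - by rewrite ij' eqxx in ij.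
exists (i - j)%N; first by rewrite subn_gt0.
have := Ksub _ _ (fP i) (fP j); rewrite fij opprB addrA subrK natrB ?scalerBl //.
exact: ltnW.
Qed.

Lemma sublattice_mul (K Lam : set 'rV[R]_n) y : finite_index_sublattice K Lam ->
  K y -> forall i : nat, K (i%:R *: y).
Proof.
move=> [_ [K0 Ksub] _] Ky; elim=> [|i IHi]; first by rewrite scale0r.
have -> : i.+1%:R *: y = i%:R *: y - (0 - y).
  by rewrite sub0r opprK -natr1 scalerDl scale1r.
exact: (Ksub _ _ IHi (Ksub _ _ K0 Ky)).
Qed.

(** Along the ray of rho the counting function is eventually polynomial with
    constant term c, for all steps that are multiples of some N. *)
Lemma periodic_constant_line (I : {set 'I_n}) h c : is_periodic_constant e b I h c ->
  exists2 N : nat, (0 < N)%N & forall m : nat, (0 < m)%N -> exists p : {poly R},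
    p.[0] = c /\ exists t0 : nat, forall t : nat, (t0 <= t)%N ->
      p.[t%:R] = (counting e b I h ((t * (m * N))%:R *: proj I rho))%:~R.
Proof.
move=> [K [l0 [q [Kfin [l /real_coneP al ll0] [M' M'fin qP] qE ->]]]].
have projZ t x : proj I (t *: x) = t *: proj I x :> 'rV[R]_n.
  by apply/rowP => v; rewrite !mxE; case: ifP; rewrite ?mulr0.
have rho_dual (i : nat) : dual_lattice e b (i%:R *: rho).
  by apply/dual_latticeP => v; rewrite dual_coordZ dual_coord_rho mulr1 natr_int.
have [j j0 Kj] := finite_index_multiple (y := proj I rho) Kfin
  (fun i => ex_intro2 _ _ (i%:R *: rho) (rho_dual i) (projZ _ _)).
have [j' j'0 Mj] := finite_index_multiple M'fin (sublattice_mul Kfin Kj).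
exists (j' * j)%N => [|m m0]; first by rewrite muln_gt0 j'0.
have [_ [K0 _] _] := Kfin; have [P PE] := qP _ K0.
pose y := (m * (j' * j))%:R *: proj I rho.
have My (t : nat) : M' (t%:R *: y).
  have := sublattice_mul M'fin Mj (t * m); rewrite !scalerA -!natrM.
  by rewrite -!mulnA.
have [p pE] := meval_line P (y 0).
have qp (t : nat) : q (t%:R *: y) = p.[t%:R].
  rewrite -pE (PE (t%:R *: y)) ?subr0 //.
  by congr mpoly.meval; apply: funext => v; rewrite mxE.
exists p; split; first by rewrite -[0]/(0%:R) -qp scale0r.
have [t0 t0P] : exists t0 : nat, forall v, dual_coord l v <= t0%:R.
  exists (\max_v (Num.truncn (dual_coord l v)).+1)%N => v.
  apply: le_trans (ltW (truncnS_gt _)) _; rewrite ler_nat.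
  exact: (leq_bigmax v).
exists t0 => t tt0; rewrite -qp natrM -scalerA -/y.
apply: qE.
  have [sub _ _] := M'fin; exact: sub (My t).
rewrite -ll0 /y scalerA -projZ -projB; exists ((t%:R * (m * (j' * j))%:R) *: rho - l) => //.
apply/real_coneP => v; rewrite dual_coordB dual_coordZ dual_coord_rho mulr1 subr_ge0.
apply: le_trans (t0P v) _; rewrite -natrM ler_nat (leq_trans tt0) // leq_pmulr //.
by rewrite !muln_gt0 m0 j'0.
Qed.

Lemma periodic_constant_unique (I : {set 'I_n}) (h : set 'rV[R]_n) c c' :
  is_periodic_constant e b I h c -> is_periodic_constant e b I h c' -> c = c'.
Proof.
move=> /periodic_constant_line[N N0 pcN] /periodic_constant_line[N' N'0 pcN'].
have [p [<- [t0 pE]]] := pcN N' N'0; have [p' [<- [t1 pE']]] := pcN' N N0.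
congr (_.[_]); apply: (@poly_eventually_eq _ _ (maxn t0 t1)) => t.
by rewrite geq_max => /andP[/pE-> /pE'->]; rewrite [(N * N')%N]mulnC.
Qed.

Lemma periodic_constantE (I : {set 'I_n}) (h : set 'rV[R]_n) c :
  is_periodic_constant e b I h c -> periodic_constant e b I h = c.
Proof.
move=> pc; apply: (periodic_constant_unique _ pc).
exact: (xgetPex 0 (ex_intro (is_periodic_constant e b I h) c pc)).
Qed.

Lemma periodic_constant_formula (h : set 'rV[R]_n) : discriminant_group e b h ->
  [/\ has_periodic_constant e b [set: 'I_n]%SET h,
      (forall v w : 'I_n, e v w -> has_periodic_constant e b [set v; w]%SET h),
      (forall v : 'I_n, has_periodic_constant e b [set v]%SET h)
    & periodic_constant e b [set: 'I_n]%SET h =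
        \sum_(v < n) \sum_(w < n | (v < w)%N && e v w)
           periodic_constant e b [set v; w]%SET h
        - \sum_(v < n) ((valency e v)%:Z - 1)%:~R *
            periodic_constant e b [set v]%SET h].
Proof.
case/class_representative => r [r_dual r_ge0 r_lt1 ->]; set h0 := class_of r.
pose P1 v (qm : ('rV[R]_n -> R) * nat) := [/\ quasipoly qm.1,
  forall x y : 'rV[R]_n, x 0 v = y 0 v -> qm.1 x = qm.1 y &
  forall x, deep [set v]%SET qm.2 x -> qm.1 x = (counting e b [set v]%SET h0 x)%:~R].
have ex1 v : exists qm, P1 v qm.
  by have [q [m qP]] := vertex_quasipoly r_dual r_ge0 r_lt1 v; exists (q, m).
have [q1 q1P] := fin_all_exists ex1.
pose P2 (vw : 'I_n * 'I_n) (qm : ('rV[R]_n -> R) * nat) := e vw.1 vw.2 ->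
  [/\ quasipoly qm.1,
  forall x y : 'rV[R]_n, x 0 vw.1 = y 0 vw.1 -> x 0 vw.2 = y 0 vw.2 -> qm.1 x = qm.1 y &
  forall x, deep [set vw.1; vw.2]%SET qm.2 x ->
    qm.1 x = (counting e b [set vw.1; vw.2]%SET h0 x)%:~R].
have ex2 vw : exists qm, P2 vw qm.
  case: vw => v w; rewrite /P2 /=; have [evw|nevw] := boolP (e v w).
    by have [q [m qP]] := edge_quasipoly r_dual r_ge0 r_lt1 evw; exists (q, m).
  by exists (fun=> 0, 0%N).
have [q2 q2P] := fin_all_exists ex2.
have pc1 v : is_periodic_constant e b [set v]%SET h0 ((q1 v).1 0).
  have [qP ql qE] := q1P v; apply: quasipoly_pc qP _ qE => x y xy.
  by apply: ql; apply: xy; rewrite inE.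
have pc2 v w : e v w -> is_periodic_constant e b [set v; w]%SET h0 ((q2 (v, w)).1 0).
  move=> evw; have [qP ql qE] := q2P (v, w) evw; apply: quasipoly_pc qP _ qE => x y xy.
  by apply: ql; apply: xy; rewrite !inE eqxx ?orbT.
pose q x := \sum_(v < n) \sum_(w < n | (v < w)%N && e v w) (q2 (v, w)).1 x
  - \sum_(v < n) ((valency e v)%:Z - 1)%:~R * (q1 v).1 x.
have pcV : is_periodic_constant e b [set: 'I_n]%SET h0 (q 0).
  pose m := maxn n (maxn (\max_v (q1 v).2) (\max_vw (q2 vw).2)).
  apply: (quasipoly_pc (m := m)).
  - apply: quasipolyD.
      apply: quasipoly_sum => v _; apply: quasipoly_sum => w /andP[_ evw].
      by have [] := q2P (v, w) evw.
    apply: quasipolyN; apply: quasipoly_sum => v _.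
    by apply: quasipolyM; [exact: quasipoly_cst | have [] := q1P v].
  - move=> x y xy; congr (q _); apply/rowP => v.
    by rewrite xy // finset.in_setT.
  move=> x xdeep; have [l al xl] := xdeep.
  have xE : x = m%:R *: rho + l.
    by apply/rowP => v; rewrite xl ?finset.in_setT // !mxE.
  rewrite counting_formula //; last first.
    move=> v; rewrite xE dual_coordD dual_coordZ dual_coord_rho mulr1.
    apply: (@le_trans _ _ m%:R); last by rewrite lerDl.
    rewrite lerBlDr -[1]/(1%:R) -natrD ler_nat addn1; apply: leqW.
    by apply: leq_trans (max_card _) _; rewrite card_ord leq_maxl.
  rewrite intrB !rmorph_sum /=; congr (_ - _).
    apply: eq_bigr => v _; rewrite rmorph_sum /=; apply: eq_bigr => w /andP[_ evw].
    have [_ _ -> //] := q2P (v, w) evw.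
    apply: deepS xdeep; first exact: finset.subsetT.
    by rewrite !leq_max (leq_bigmax (v, w)) !orbT.
  apply: eq_bigr => v _; rewrite intrM; congr (_ * _).
  have [_ _ -> //] := q1P v.
  apply: deepS xdeep; first exact: finset.subsetT.
  by rewrite !leq_max (leq_bigmax v) ?orbT.
split.
- by exists (q 0).
- by move=> v w evw; exists ((q2 (v, w)).1 0); apply: pc2.
- by move=> v; exists ((q1 v).1 0).
rewrite (periodic_constantE pcV); congr (_ - _).
  apply: eq_bigr => v _; apply: eq_bigr => w /andP[_ evw].
  by rewrite (periodic_constantE (pc2 v w evw)).
by apply: eq_bigr => v _; rewrite (periodic_constantE (pc1 v)).
Qed.


End Lattice.

(** * One- and two-variable counting functions *)

Theorem corollary18 (R : realType) (n : nat) (e : rel 'I_n) (b : 'I_n -> int)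
    (htree : is_tree e) (hneg : negative_definite R e b)
    (h : set 'rV[R]_n) (hh : discriminant_group e b h) :
  (forall x : 'rV[R]_n,
     (exists2 s : 'rV[R]_n, int_semigroup e b s &
        x = \sum_v ((valency e v)%:Z - 2)%:~R *: Estar R e b v + s) ->
     counting e b [set: 'I_n]%SET h x =
       \sum_(v < n) \sum_(w < n | (v < w)%N && e v w)
          counting e b [set v; w]%SET h x
       - \sum_(v < n) ((valency e v)%:Z - 1) * counting e b [set v]%SET h x)
  /\
  [/\ has_periodic_constant e b [set: 'I_n]%SET h,
      (forall v w : 'I_n, e v w ->
         has_periodic_constant e b [set v; w]%SET h),
      (forall v : 'I_n, has_periodic_constant e b [set v]%SET h)
    & periodic_constant e b [set: 'I_n]%SET h =
        \sum_(v < n) \sum_(w < n | (v < w)%N && e v w)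
           periodic_constant e b [set v; w]%SET h
        - \sum_(v < n) ((valency e v)%:Z - 1)%:~R *
            periodic_constant e b [set v]%SET h].
Proof.
split; last exact: periodic_constant_formula.
case: (class_representative htree hh) => r [r_dual r_ge0 r_lt1 ->].
move=> x [s [a a_gt0 sE] xE]; apply: counting_formula => // v.
rewrite xE sE dual_coordD // !dual_coord_sum // intrB.
have : 1 <= (a v)%:R :> R by rewrite ler1n.
by rewrite -[(valency e v)%:Z%:~R]/((valency e v)%:R); lra.
Qed.
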